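(* Every Rota-Baxter Lie algebra $(\mathfrak g,R)$ of weight $1$ over $\mathbf k$ has a universal Rota-Baxter $p$-envelope, namely $(\mathfrak g^{(p)},(-)^p,R,i)$, where $\mathfrak g^{(p)}=\mathrm{span}_{\mathbf k}\{x^{p^k}\in\mathrm U(\mathfrak g)\mid x\in\mathfrak g,\ k\ge0\}$ is the Lie algebra of primitive elements of $\mathrm U(\mathfrak g)$ (commutator bracket), $(-)^p$ is the $p$-th power in $\mathrm U(\mathfrak g)$, $R$ on $\mathfrak g^{(p)}$ is the restriction of the extension of $R$ to $\mathrm U(\mathfrak g)$, and $i:\mathfrak g\to\mathfrak g^{(p)}$ is the natural embedding.
   Context: Convention: $\mathbf k$ is an algebraically closed field of prime characteristic $p$; everything is over $\mathbf k$. Rota-Baxter Lie algebra of weight $\lambda$: a Lie algebra with a linear map $R$ such that $[R(x),R(y)]=R([R(x),y])+R([x,R(y)])+\lambda R([x,y])$ for all $x,y$. Extension to $\mathrm U(\mathfrak g)$ (Goncharov): a Rota-Baxter operator $R$ of weight $1$ on $\mathfrak g$ extends to a well-defined linear map $R:\mathrm U(\mathfrak g)\to\mathrm U(\mathfrak g)$ determined by $R(1)=1$ and $R(xy)=R(x)R(y)-R([R(x),y])$ for $x\in\mathfrak g$, $y\in\mathrm U(\mathfrak g)$ (commutator in $\mathrm U(\mathfrak g)$). It is a coalgebra endomorphism (elements of $\mathfrak g$ primitive) satisfying $R(x)R(y)=R(x_1R(x_2)\,y\,S(R(x_3)))$ for all $x,y\in\mathrm U(\mathfrak g)$ (Sweedler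 notation, $S$ the antipode). Restricted Lie algebra: a Lie algebra $(\mathfrak g,[-,-])$ with a $p$-map $(-)^{[p]}:\mathfrak g\to\mathfrak g$ satisfying $(ax)^{[p]}=a^px^{[p]}$ for $a\in\mathbf k$, $[x^{[p]},y]=(\mathrm{ad}_x)^p(y)$, and $(x+y)^{[p]}=x^{[p]}+y^{[p]}+\sum_{i=1}^{p-1}s_i(x,y)$, where $i\,s_i(x,y)$ is the coefficient of $t^{i-1}$ in $(\mathrm{ad}_{tx+y})^{p-1}(x)\in\mathbf k[t]\otimes\mathfrak g$. For a composition $\alpha=(\alpha_1,\dots,\alpha_r)\vDash n$ (a tuple of positive integers with sum $n$, of length $\ell(\alpha)=r$), $C_\alpha=\prod_{k=1}^r\binom{\alpha_1+\cdots+\alpha_k-1}{\alpha_k-1}$. A restricted Rota-Baxter Lie algebra $(\mathfrak g,[-,-],(-)^{[p]},R)$ of weight $\lambda$ is a restricted Lie algebra with a Rota-Baxter operator $R$ of weight $\lambda$ such that $R(x^{[p]_R})=R(x)^{[p]}$ for all $x\in\mathfrak g$, where, with $x\rhd_Ry:=[R(x),y]$ and $x^{\rhd_Rk}:=x\rhd_R(x\rhd_R\cdots(x\rhd_Rx)\cdots)$ ($k$ copies of $x$, $x^{\rhd_R1}=x$), $$x^{[p]_R}:=\lambda^{p-1}x^{[p]}+\sum_{r=1}^{p-1}\frac1r\lambda^{r-1}\sum_{\alpha\vDash p,\ \ell(\alpha)=r}C_\alpha\,[x^{\rhd_R\alpha_1},[x^{\rhd_R\alpha_2},[\cdots[x^{\rhd_R\alpha_{r-1}},x^{\rhd_R\alpha_r}]\cdots]]]$$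 ($\frac1r$ is the inverse of $r$ modulo $p$). Homomorphisms of (restricted) Rota-Baxter Lie algebras are Lie algebra homomorphisms commuting with the Rota-Baxter operators (and the $p$-maps). A Rota-Baxter $p$-subalgebra of a restricted Rota-Baxter Lie algebra is a Lie subalgebra stable under $R$ and closed under the $p$-map; for a subset $E$, $E_p$ is the intersection of all Rota-Baxter $p$-subalgebras containing $E$. A Rota-Baxter $p$-envelope of a Rota-Baxter Lie algebra $(\mathfrak g,R)$ is a tuple $(\mathfrak l,(-)^{[p]'},R',i)$ with $(\mathfrak l,(-)^{[p]'},R')$ a restricted Rota-Baxter Lie algebra (of the same weight) and $i:\mathfrak g\to\mathfrak l$ an injective Rota-Baxter Lie algebra homomorphism with $i(\mathfrak g)_p=\mathfrak l$. It is universal if for every restricted Rota-Baxter Lie algebra $\mathfrak c$ (of the same weight) and Rota-Baxter Lie algebra homomorphism $f:\mathfrak g\to\mathfrak c$ there is a unique restricted Rota-Baxter Lie algebra homomorphism $g:\mathfrak l\to\mathfrak c$ with $g\circ i=f$. *)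

(* Defs.v *)
From HB Require Import structures.
From mathcomp Require Import all_boot all_order all_algebra.
From mathcomp Require Import boolp classical_sets.

Set Implicit Arguments.
Unset Strict Implicit.
Unset Printing Implicit Defensive.

Import GRing.Theory.
Local Open Scope ring_scope.
Local Open Scope quotient_scope.
Local Open Scope classical_set_scope.

Section Terms.
Variables (k : fieldType) (X : Type).

Inductive term :=
  | TGen of X
  | TScal of k
  | TAdd of term & term
  | TMul of term & term.

Definition topp t := TMul (TScal (-1)) t.

Fixpoint teval (A : algType k) (f : X -> A) (t : term) : A :=
  match t with
  | TGen x => f x
  | TScal a => a%:A
  | TAdd t u => teval f t + teval f u
  | TMul t u => teval f t * teval f u
  end.

HB.instance Definition _ := gen_eqMixin term.
HB.instance Definition _ := gen_choiceMixin term.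

End Terms.
Arguments TScal {k X} _.
Arguments TGen {k X} _.

(* [augval] sends the generators to a point of [k] where all the relations
   hold. It has no influence on the presented algebra, but shows that the
   latter is nonzero, as required by [algType]. *)
Record presentation (k : fieldType) := Presentation {
  gens : Type;
  rels : term k gens -> term k gens -> Prop;
  augval : gens -> k^o;
  augvalP : forall t u, rels t u -> teval augval t = teval augval u }.

Section PresentedAlgebra.
Variables (k : fieldType) (P : presentation k).

(* The least congruence making terms a unital associative k-algebra in which
   the relations of P hold. *)
Inductive teq : term k (gens P) -> term k (gens P) -> Prop :=
  | teq_rel t u of rels t u : teq t u
  | teq_refl t : teq t t
  | teq_sym t u of teq t u : teq u t
  | teq_trans t u v of teq t u & teq u v : teq t v
  | teq_add t t' u u' of teq t t' & teq u u' : teq (TAdd t u) (TAdd t' u')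
  | teq_mul t t' u u' of teq t t' & teq u u' : teq (TMul t u) (TMul t' u')
  | teq_addA t u v : teq (TAdd t (TAdd u v)) (TAdd (TAdd t u) v)
  | teq_addC t u : teq (TAdd t u) (TAdd u t)
  | teq_add0 t : teq (TAdd (TScal 0) t) t
  | teq_mulA t u v : teq (TMul t (TMul u v)) (TMul (TMul t u) v)
  | teq_mul1l t : teq (TMul (TScal 1) t) t
  | teq_mul1r t : teq (TMul t (TScal 1)) t
  | teq_mul0 t : teq (TMul (TScal 0) t) (TScal 0)
  | teq_mulDl t u v : teq (TMul (TAdd t u) v) (TAdd (TMul t v) (TMul u v))
  | teq_mulDr t u v : teq (TMul t (TAdd u v)) (TAdd (TMul t u) (TMul t v))
  | teq_scalD a b : teq (TScal (a + b)) (TAdd (TScal a) (TScal b))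
  | teq_scalM a b : teq (TScal (a * b)) (TMul (TScal a) (TScal b))
  | teq_scalC a t : teq (TMul (TScal a) t) (TMul t (TScal a)).

Definition teqb : rel (term k (gens P)) := fun t u => `[< teq t u >].

Fact teqb_refl : reflexive teqb.
Proof. by move=> t; apply/asboolP; apply: teq_refl. Qed.

Fact teqb_sym : symmetric teqb.
Proof. by move=> t u; apply/asboolP/asboolP; apply: teq_sym. Qed.

Fact teqb_trans : transitive teqb.
Proof.
by move=> u t v /asboolP tu /asboolP uv; apply/asboolP; apply: teq_trans uv.
Qed.

Canonical teq_equiv := EquivRel teqb teqb_refl teqb_sym teqb_trans.

Definition palg := {eq_quot teq_equiv}.
HB.instance Definition _ := Choice.on palg.
HB.instance Definition _ := EqQuotient.on palg.

Lemma palgP t u : teq t u <-> \pi_palg t = \pi_palg u.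
Proof.
split=> [tu|/eqP]; first by apply/eqP; rewrite eqmodE; apply/asboolP.
by rewrite eqmodE => /asboolP.
Qed.

Lemma repr_teq t : teq (repr (\pi_palg t)) t.
Proof. by apply/palgP; rewrite reprK. Qed.

Definition pgen (x : gens P) : palg := \pi_palg (TGen x).
Definition pscal (a : k) : palg := \pi_palg (TScal a).
Definition padd (u v : palg) : palg := \pi_palg (TAdd (repr u) (repr v)).
Definition pmul (u v : palg) : palg := \pi_palg (TMul (repr u) (repr v)).
Definition popp (u : palg) : palg := pmul (pscal (-1)) u.
Definition pscale (a : k) (u : palg) : palg := pmul (pscal a) u.

Lemma paddE t u : padd (\pi_palg t) (\pi_palg u) = \pi_palg (TAdd t u).
Proof. by apply/palgP/teq_add; apply: repr_teq. Qed.

Lemma pmulE t u : pmul (\pi_palg t) (\pi_palg u) = \pi_palg (TMul t u).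
Proof. by apply/palgP/teq_mul; apply: repr_teq. Qed.

Lemma palgW (Q : palg -> Prop) : (forall t, Q (\pi_palg t)) -> forall u, Q u.
Proof. by move=> H u; rewrite -[u]reprK. Qed.

Let pE := (paddE, pmulE).

Fact paddA : associative padd.
Proof.
elim/palgW=> t; elim/palgW=> u; elim/palgW=> v; rewrite !pE.
by apply/palgP; constructor.
Qed.

Fact paddC : commutative padd.
Proof.
elim/palgW=> t; elim/palgW=> u; rewrite !pE.
by apply/palgP; constructor.
Qed.

Fact padd0 : left_id (pscal 0) padd.
Proof. by elim/palgW=> t; rewrite !pE; apply/palgP; constructor. Qed.

Fact pmulA : associative pmul.
Proof.
elim/palgW=> t; elim/palgW=> u; elim/palgW=> v; rewrite !pE.
by apply/palgP; constructor.
Qed.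

Fact pmul1l : left_id (pscal 1) pmul.
Proof. by elim/palgW=> t; rewrite !pE; apply/palgP; constructor. Qed.

Fact pmul1r : right_id (pscal 1) pmul.
Proof. by elim/palgW=> t; rewrite !pE; apply/palgP; constructor. Qed.

Fact pmul0 u : pmul (pscal 0) u = pscal 0.
Proof. by elim/palgW: u => t; rewrite !pE; apply/palgP; constructor. Qed.

Fact pmulDl : left_distributive pmul padd.
Proof.
elim/palgW=> t; elim/palgW=> u; elim/palgW=> v; rewrite !pE.
by apply/palgP; constructor.
Qed.

Fact pmulDr : right_distributive pmul padd.
Proof.
elim/palgW=> t; elim/palgW=> u; elim/palgW=> v; rewrite !pE.
by apply/palgP; constructor.
Qed.

Fact pscalD a b : pscal (a + b) = padd (pscal a) (pscal b).
Proof. by rewrite !pE; apply/palgP; constructor. Qed.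

Fact pscalM a b : pscal (a * b) = pmul (pscal a) (pscal b).
Proof. by rewrite !pE; apply/palgP; constructor. Qed.

Fact pscalC a u : pmul (pscal a) u = pmul u (pscal a).
Proof. by elim/palgW: u => t; rewrite !pE; apply/palgP; constructor. Qed.

Fact paddN : left_inverse (pscal 0) popp padd.
Proof.
by move=> u; rewrite /popp -{2}[u]pmul1l -pmulDl -pscalD addNr pmul0.
Qed.

HB.instance Definition _ := GRing.isZmodule.Build palg paddA paddC padd0 paddN.

Lemma teq_teval (A : algType k) (f : gens P -> A) :
    (forall t u, rels t u -> teval f t = teval f u) ->
  forall t u, teq t u -> teval f t = teval f u.
Proof.
move=> fP t u; elim=> //=.
- by move=> ? ? ? _ -> _ ->.
- by move=> ? ? ? ? _ -> _ ->.
- by move=> ? ? ? ? _ -> _ ->.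
- by move=> ? ? ?; rewrite addrA.
- by move=> ? ?; rewrite addrC.
- by move=> ?; rewrite scale0r add0r.
- by move=> ? ? ?; rewrite mulrA.
- by move=> ?; rewrite scale1r mul1r.
- by move=> ?; rewrite scale1r mulr1.
- by move=> ?; rewrite scale0r mul0r.
- by move=> ? ? ?; rewrite mulrDl.
- by move=> ? ? ?; rewrite mulrDr.
- by move=> ? ?; rewrite scalerDl.
- by move=> ? ?; rewrite -scalerAl mul1r scalerA.
- by move=> ? ?; rewrite -scalerAl mul1r -scalerAr mulr1.
Qed.

Fact pone_neq0 : pscal 1 != 0.
Proof.
apply/eqP => /palgP /(teq_teval (@augvalP _ P))/= /eqP.
by rewrite scale0r scale1r oner_eq0.
Qed.

HB.instance Definition _ := GRing.Zmodule_isNzRing.Build palg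
  pmulA pmul1l pmul1r pmulDl pmulDr pone_neq0.

Fact pscaleA a b u : pscale a (pscale b u) = pscale (a * b) u.
Proof. by rewrite /pscale pscalM pmulA. Qed.

Fact pscaleDr : right_distributive pscale +%R.
Proof. by move=> a u v; apply: pmulDr. Qed.

Fact pscaleDl u : {morph pscale^~ u : a b / a + b}.
Proof. by move=> a b; rewrite /pscale pscalD pmulDl. Qed.

HB.instance Definition _ := GRing.Zmodule_isLmodule.Build k palg
  pscaleA pmul1l pscaleDr pscaleDl.

Fact pscaleAl (a : k) (u v : palg) : a *: (u * v) = (a *: u) * v.
Proof. exact: pmulA. Qed.

HB.instance Definition _ := GRing.Lmodule_isLalgebra.Build k palg pscaleAl.

Fact pscaleAr (a : k) (u v : palg) : a *: (u * v) = u * (a *: v).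
Proof.
change (pmul (pscal a) (pmul u v) = pmul u (pmul (pscal a) v)).
by rewrite pmulA pscalC -!pmulA.
Qed.

HB.instance Definition _ := GRing.Lalgebra_isAlgebra.Build k palg pscaleAr.

(* The algebra morphism extending f, when f satisfies the relations of P. *)
Definition plift (A : algType k) (f : gens P -> A) (u : palg) : A :=
  teval f (repr u).

Section Lift.
Variables (A : algType k) (f : gens P -> A).
Hypothesis fP : forall t u, rels t u -> teval f t = teval f u.

Lemma plift_pi t : plift f (\pi_palg t) = teval f t.
Proof. exact/(teq_teval fP)/repr_teq. Qed.

Lemma plift_gen x : plift f (pgen x) = f x.
Proof. exact: plift_pi. Qed.

Lemma pliftD u v : plift f (u + v) = plift f u + plift f v.
Proof. by rewrite [LHS]plift_pi. Qed.

Lemma pliftM u v : plift f (u * v) = plift f u * plift f v.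
Proof. by rewrite [LHS]plift_pi. Qed.

Lemma plift_scal a : plift f (pscal a) = a%:A.
Proof. exact: plift_pi. Qed.

Lemma plift1 : plift f 1 = 1.
Proof. by rewrite [LHS]plift_scal scale1r. Qed.

Lemma pliftZ a u : plift f (a *: u) = a *: plift f u.
Proof. by rewrite [LHS]pliftM plift_scal -scalerAl mul1r. Qed.

End Lift.

Lemma plift_unique (A : algType k) (h h' : {lrmorphism palg -> A}) :
  (forall x, h (pgen x) = h' (pgen x)) -> h =1 h'.
Proof.
have scalE a : \pi_palg (TScal a) = a%:A by rewrite -[LHS]pmul1r.
move=> hh'; elim/palgW; elim=> [x|a|t IHt u IHu|t IHt u IHu].
- exact: hh'.
- by rewrite scalE !linearZ/= !rmorph1.
- by rewrite -paddE !raddfD/= IHt IHu.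
- by rewrite -pmulE !rmorphM/= IHt IHu.
Qed.

Definition paug : palg -> k^o := plift (@augval k P).

End PresentedAlgebra.

Section Tensor.
Variables (k : fieldType) (P Q : presentation k).
Notation A := (palg P).
Notation B := (palg Q).

Inductive tensor_rels : term k (A * B) -> term k (A * B) -> Prop :=
  | tensor_addl a a' b : tensor_rels
      (TGen (a + a', b)) (TAdd (TGen (a, b)) (TGen (a', b)))
  | tensor_addr a b b' : tensor_rels
      (TGen (a, b + b')) (TAdd (TGen (a, b)) (TGen (a, b')))
  | tensor_scalel c a b : tensor_rels
      (TGen (c *: a, b)) (TMul (TScal c) (TGen (a, b)))
  | tensor_scaler c a b : tensor_rels
      (TGen (a, c *: b)) (TMul (TScal c) (TGen (a, b)))
  | tensor_one : tensor_rels (TGen (1, 1)) (TScal 1)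
  | tensor_mul a b a' b' : tensor_rels
      (TGen (a * a', b * b')) (TMul (TGen (a, b)) (TGen (a', b'))).

Definition tensor_aug (u : A * B) : k^o := (paug u.1 : k) * paug u.2.

Fact tensor_augP t u :
  tensor_rels t u -> teval tensor_aug t = teval tensor_aug u.
Proof.
have PP := @augvalP k P; have QP := @augvalP k Q.
case=> *; rewrite /= /tensor_aug/= /paug.
- by rewrite pliftD // mulrDl.
- by rewrite pliftD // mulrDr.
- by rewrite pliftZ // /GRing.scale/= mulr1 mulrA.
- by rewrite pliftZ // /GRing.scale/= mulr1 mulrCA.
- by rewrite !plift1 // mulr1 scale1r.
- by rewrite !pliftM //; apply: mulrACA.
Qed.

Definition tensor_presentation := Presentation tensor_augP.
Definition tensor : algType k := palg tensor_presentation.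
Definition tens (a : A) (b : B) : tensor := pgen (P := tensor_presentation) (a, b).

Let tensP (t u : term k (A * B)) :
  tensor_rels t u -> \pi_(palg tensor_presentation) t = \pi u.
Proof. by move=> tu; apply/palgP/teq_rel. Qed.

Lemma tensDl a a' b : tens (a + a') b = tens a b + tens a' b.
Proof. by rewrite [RHS]paddE; apply/tensP/tensor_addl. Qed.

Lemma tensDr a b b' : tens a (b + b') = tens a b + tens a b'.
Proof. by rewrite [RHS]paddE; apply/tensP/tensor_addr. Qed.

Lemma tensZl c a b : tens (c *: a) b = c *: tens a b.
Proof. by rewrite [RHS]pmulE; apply/tensP/tensor_scalel. Qed.

Lemma tensZr c a b : tens a (c *: b) = c *: tens a b.
Proof. by rewrite [RHS]pmulE; apply/tensP/tensor_scaler. Qed.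

Lemma tens11 : tens 1 1 = 1.
Proof. exact/tensP/tensor_one. Qed.

Lemma tensM a b a' b' : tens (a * a') (b * b') = tens a b * tens a' b'.
Proof. by rewrite [RHS]pmulE; apply/tensP/tensor_mul. Qed.

End Tensor.

Definition commutator (k : fieldType) (A : algType k) (u v : A) : A :=
  u * v - v * u.

Section UEA.
Variables (k : fieldType) (g : lmodType k) (br : g -> g -> g).

Inductive uea_rels : term k g -> term k g -> Prop :=
  | uea_add x y : uea_rels (TGen (x + y)) (TAdd (TGen x) (TGen y))
  | uea_scale a x : uea_rels (TGen (a *: x)) (TMul (TScal a) (TGen x))
  | uea_br x y : uea_rels (TGen (br x y))
      (TAdd (TMul (TGen x) (TGen y)) (topp (TMul (TGen y) (TGen x)))).

Fact uea_augP t u : uea_rels t u ->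
  teval (fun=> 0 : k^o) t = teval (fun=> 0 : k^o) u.
Proof. by case=> *; rewrite /= ?mulr0 ?addr0. Qed.

Definition uea_presentation := Presentation uea_augP.
Definition uea : algType k := palg uea_presentation.
Definition uea_gen (x : g) : uea := pgen (P := uea_presentation) x.

Let ueaP (t u : term k g) : uea_rels t u -> \pi_(palg uea_presentation) t = \pi u.
Proof. by move=> tu; apply/palgP/teq_rel. Qed.

Lemma uea_genD x y : uea_gen (x + y) = uea_gen x + uea_gen y.
Proof. by rewrite [RHS]paddE; apply/ueaP/uea_add. Qed.

Lemma uea_genZ a x : uea_gen (a *: x) = a *: uea_gen x.
Proof. by rewrite [RHS]pmulE; apply/ueaP/uea_scale. Qed.

Lemma uea_gen_br x y : uea_gen (br x y) = commutator (uea_gen x) (uea_gen y).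
Proof.
have -> : commutator (uea_gen x) (uea_gen y) = \pi_(palg uea_presentation)
    (TAdd (TMul (TGen x) (TGen y)) (topp (TMul (TGen y) (TGen x)))).
  by rewrite -paddE -!pmulE.
exact/ueaP/uea_br.
Qed.

Section Lift.
Variables (A : algType k) (f : g -> A).
Hypotheses (fD : forall x y, f (x + y) = f x + f y)
  (fZ : forall a x, f (a *: x) = a *: f x)
  (fbr : forall x y, f (br x y) = commutator (f x) (f y)).

Lemma uea_relsP t u : uea_rels t u -> teval f t = teval f u.
Proof.
case=> [x y|a x|x y] /=; first exact: fD.
  by rewrite fZ -scalerAl mul1r.
by rewrite fbr scaleN1r mulN1r.
Qed.

End Lift.

Definition comult_gen (x : g) : tensor uea_presentation uea_presentation :=
  tens (uea_gen x) 1 + tens 1 (uea_gen x).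

Definition comult : uea -> tensor uea_presentation uea_presentation :=
  plift (P := uea_presentation) comult_gen.

Lemma comult_genP t u :
  uea_rels t u -> teval comult_gen t = teval comult_gen u.
Proof.
apply: uea_relsP => [x y|a x|x y]; rewrite /comult_gen.
- by rewrite uea_genD tensDl tensDr addrACA.
- by rewrite uea_genZ tensZl tensZr scalerDr.
- rewrite uea_gen_br /commutator tensDl tensDr -!scaleN1r tensZl tensZr.
  rewrite !mulrDl !mulrDr -!tensM !mulr1 !mul1r !scaleN1r !opprD !addrA.
  by rewrite [RHS](AC 8 (1*5*4*8*(3*6)*(2*7))) /= !subrr !addr0.
Qed.

Definition primitives : set uea :=
  [set u | comult u = tens u 1 + tens 1 u].

End UEA.

Section Defs.
Variable k : fieldType.
Implicit Types (L M : lmodType k) (lam : k) (p : nat).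

Definition lie_algebra L (br : L -> L -> L) : Prop :=
  [/\ forall x, linear (br x),
      forall y, linear (br^~ y),
      forall x, br x x = 0 &
      forall x y z, br x (br y z) + br y (br z x) + br z (br x y) = 0].

Definition rota_baxter lam L (br : L -> L -> L) (R : L -> L) : Prop :=
  linear R /\
  forall x y, br (R x) (R y) =
    R (br (R x) y) + R (br x (R y)) + lam *: R (br x y).

Definition rb_lie_algebra lam L (br : L -> L -> L) (R : L -> L) : Prop :=
  lie_algebra br /\ rota_baxter lam br R.

(* An element of k[t] (x) L is encoded by its sequence of coefficients; this is
   the action on it of ad_(tx + y). *)
Definition ad_txy L (br : L -> L -> L) (x y : L) (v : nat -> L) : nat -> L :=
  fun n => (if n is m.+1 then br x (v m) else 0) + br y (v n).

Definition jacobson_s p L (br : L -> L -> L) (i : nat) (x y : L) : L :=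
  (i%:R : k)^-1 *:
    iter p.-1 (ad_txy br x y) (fun n => if n == 0%N then x else 0) i.-1.

Definition p_map p L (br : L -> L -> L) (pm : L -> L) : Prop :=
  [/\ forall a x, pm (a *: x) = a ^+ p *: pm x,
      forall x y, br (pm x) y = iter p (br x) y &
      forall x y, pm (x + y) =
        pm x + pm y + \sum_(1 <= i < p) jacobson_s p br i x y].

Definition is_composition (n r : nat) (al : r.-tuple 'I_n.+1) : bool :=
  all (fun i : 'I_n.+1 => (0 < i)%N) al && (sumn [seq val i | i <- al] == n).

Definition comp_coef (s : seq nat) : nat :=
  (\prod_(j < size s) 'C((sumn (take j.+1 s)).-1, (nth 0 s j).-1))%N.

Fixpoint iter_br L (br : L -> L -> L) (s : seq L) : L :=
  match s with
  | [::] => 0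
  | [:: x] => x
  | x :: s' => br x (iter_br br s')
  end.

Definition rb_pow L (br : L -> L -> L) (R : L -> L) (x : L) (n : nat) : L :=
  iter n.-1 (br (R x)) x.

Definition p_map_R p lam L (br : L -> L -> L) (pm R : L -> L) (x : L) : L :=
  lam ^+ p.-1 *: pm x +
  \sum_(1 <= r < p) ((r%:R)^-1 * lam ^+ r.-1) *:
    \sum_(al : r.-tuple 'I_p.+1 | is_composition al)
      (comp_coef [seq val i | i <- al])%:R *:
        iter_br br [seq rb_pow br R x (val i) | i <- al].

Definition restricted_rb_lie_algebra p lam L (br : L -> L -> L)
    (pm R : L -> L) : Prop :=
  [/\ rb_lie_algebra lam br R, p_map p br pm &
      forall x, R (p_map_R p lam br pm R x) = pm (R x)].

Definition rb_hom L (brL : L -> L -> L) (RL : L -> L)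
    M (brM : M -> M -> M) (RM : M -> M) (f : L -> M) : Prop :=
  [/\ linear f, forall x y, f (brL x y) = brM (f x) (f y) &
      forall x, f (RL x) = RM (f x)].

Definition restricted_rb_hom L (brL : L -> L -> L) (pmL RL : L -> L)
    M (brM : M -> M -> M) (pmM RM : M -> M) (f : L -> M) : Prop :=
  rb_hom brL RL brM RM f /\ forall x, f (pmL x) = pmM (f x).

Definition rb_p_subalgebra L (br : L -> L -> L) (pm R : L -> L)
    (S : set L) : Prop :=
  [/\ S 0 /\ (forall a x y, S x -> S y -> S (a *: x + y)),
      forall x y, S x -> S y -> S (br x y),
      forall x, S x -> S (R x) &
      forall x, S x -> S (pm x)].

Definition rb_p_closure L (br : L -> L -> L) (pm R : L -> L)
    (E : set L) : set L :=
  smallest (rb_p_subalgebra br pm R) E.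

Definition rb_p_envelope p lam (g : lmodType k) (br : g -> g -> g) (R : g -> g)
    (l : lmodType k) (br' : l -> l -> l) (pm' R' : l -> l) (i : g -> l) :
    Prop :=
  [/\ restricted_rb_lie_algebra p lam br' pm' R',
      rb_hom br R br' R' i,
      injective i &
      rb_p_closure br' pm' R' (range i) = setT].

Definition universal_rb_p_envelope p lam (g : lmodType k) (br : g -> g -> g)
    (R : g -> g) (l : lmodType k) (br' : l -> l -> l) (pm' R' : l -> l)
    (i : g -> l) : Prop :=
  rb_p_envelope p lam br R br' pm' R' i /\
  forall (c : lmodType k) (brc : c -> c -> c) (pmc Rc : c -> c),
    restricted_rb_lie_algebra p lam brc pmc Rc ->
  forall f : g -> c, rb_hom br R brc Rc f ->
  exists! h : l -> c,
    restricted_rb_hom br' pm' R' brc pmc Rc h /\ h \o i = f.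

Definition linspan L (E : set L) : set L :=
  [set v | exists n (a : 'I_n -> k) (e : 'I_n -> L),
     (forall j, E (e j)) /\ v = \sum_(j < n) a j *: e j].

(* Goncharov's extension of R to the enveloping algebra. *)
Definition rb_extension (g : lmodType k) (br : g -> g -> g) (R : g -> g)
    (RU : uea br -> uea br) : Prop :=
  [/\ linear RU,
      forall x, RU (uea_gen br x) = uea_gen br (R x),
      RU 1 = 1 &
      forall x (y : uea br), RU (uea_gen br x * y) =
        RU (uea_gen br x) * RU y - RU (commutator (RU (uea_gen br x)) y)].

End Defs.

Section Gp.
Variables (k : fieldType) (p : nat) (g : lmodType k) (br : g -> g -> g).

Definition gp_set : set (uea br) :=
  linspan [set u | exists x n, u = uea_gen br x ^+ (p ^ n)%N].

Definition gp_pred : {pred uea br} := fun u => `[< gp_set u >].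

Lemma in_gp u : (u \in gp_pred) = `[< gp_set u >].
Proof. by []. Qed.

Fact gp_submod_closed : submod_closed gp_pred.
Proof.
split=> [|c u v]; rewrite !in_gp.
  apply/asboolP; exists 0%N; exists (fun=> 0); exists (fun=> 0).
  by split=> [[]//|]; rewrite big_ord0.
move=> /asboolP[n [a [e [eP ->]]]] /asboolP[m [b [f [fP ->]]]]; apply/asboolP.
pose glue T (h : 'I_n -> T) (h' : 'I_m -> T) j :=
  match fintype.split j with inl j => h j | inr j => h' j end.
exists (n + m)%N; exists (glue _ (fun j => c * a j) b); exists (glue _ e f).
split; first by move=> j; rewrite /glue; case: fintype.split.
rewrite big_split_ord/= scaler_sumr /glue; congr (_ + _); apply: eq_bigr => j _.
  by rewrite (unsplitK (inl _ j)) scalerA.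
by rewrite (unsplitK (inr _ j)).
Qed.

HB.instance Definition _ :=
  GRing.isSubmodClosed.Build k (uea br) gp_pred gp_submod_closed.

Record gp := Gp { gp_val :> uea br; _ : gp_val \in gp_pred }.

HB.instance Definition _ := [isSub for gp_val].
HB.instance Definition _ := [Choice of gp by <:].
HB.instance Definition _ := [SubChoice_isSubLmodule of gp by <:].

End Gp.

Arguments primitives {k g} br.
Arguments gp_set {k} p {g} br.
Arguments gp {k} p {g} br.
Arguments rb_extension {k g} br R RU.

(* Main.v *)
Require Import Defs.
From mathcomp Require Import all_boot all_order all_algebra.
From mathcomp Require Import boolp classical_sets functions wochoice.
From mathcomp Require Import zify.

(** Fix a well-ordered basis [e] of [g]. Straightening words by Jacobson's
    argument gives the Poincare-Birkhoff-Witt theorem in the form: a map on the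
    sorted words extends to a linear map on [U(g)]. Evaluating the coproduct of
    a primitive element on pairs of coordinate functions kills every coordinate
    at a sorted word which is not [e_i ^ (p ^ n)], so these powers form a basis
    of the primitive elements.

    With [[x, y]_R = [R x, y] + [x, R y] + [x, y]], both [R] and [R + id] are
    Lie morphisms to [g], and [U(g)] acts on [U(g_R)]; applying this action to
    [1] and then the algebra morphism [U(g_R) -> U(g)] induced by [R] gives the
    extension of [R].

    In weight 1 the operation [x^[p]_R] is [(x + R x)^[p] - (R x)^[p]]: its sum
    over compositions is the expansion of the [s_i (x, R x)] of Jacobson's
    formula. On the other hand [R u * R v = R (u v + [R u, v])], and the
    operator [v |-> u v + [R u, v]] is the difference of the commuting
    operators of left multiplication by [u + R u] and right multiplication by
    [R u], so that [(R u)^p = R ((u + R u)^p - (R u)^p)]. As commutators of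
    primitive elements lie in [g], this propagates from [g] to all
    [x ^ (p ^ n)], and so does compatibility with [R] of the linear map
    [e_i ^ (p ^ n) |-> f(e_i)^[p]^n] giving the universal property. *)

Set Implicit Arguments.
Unset Strict Implicit.
Unset Printing Implicit Defensive.

Import GRing.Theory.
Local Open Scope ring_scope.
Local Open Scope quotient_scope.

(** * Linear maps, submodules and bases *)

Section LinearMaps.
Variables (k : fieldType) (V W : lmodType k) (f : V -> W).
Hypothesis f_lin : linear f.

Lemma linearP_D u v : f (u + v) = f u + f v.
Proof. by rewrite -[u]scale1r f_lin !scale1r. Qed.

Lemma linearP_0 : f 0 = 0.
Proof. by apply: (addrI (f 0)); rewrite -linearP_D !addr0. Qed.

Lemma linearP_Z a u : f (a *: u) = a *: f u.
Proof. by rewrite -[a *: u]addr0 f_lin linearP_0 addr0. Qed.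

Lemma linearP_N u : f (- u) = - f u.
Proof. by rewrite -scaleN1r linearP_Z scaleN1r. Qed.

Lemma linearP_B u v : f (u - v) = f u - f v.
Proof. by rewrite linearP_D linearP_N. Qed.

Lemma linearP_sum (J : Type) (s : seq J) (P : pred J) (F : J -> V) :
  f (\sum_(j <- s | P j) F j) = \sum_(j <- s | P j) f (F j).
Proof. exact: (big_morph f linearP_D linearP_0). Qed.

End LinearMaps.

Definition submodule (k : fieldType) (V : lmodType k) (S : V -> Prop) : Prop :=
  S 0 /\ forall a u v, S u -> S v -> S (a *: u + v).

Section Submodules.
Variables (k : fieldType) (V : lmodType k) (S : V -> Prop).
Hypothesis subS : submodule S.

Lemma submodule0 : S 0. Proof. by case: subS. Qed.

Lemma submoduleD u v : S u -> S v -> S (u + v).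
Proof. by case: subS => _ SP Su Sv; rewrite -[u]scale1r; apply: SP. Qed.

Lemma submoduleZ a u : S u -> S (a *: u).
Proof. by case: subS => S0 SP Su; rewrite -[_ *: _]addr0; apply: SP. Qed.

Lemma submoduleN u : S u -> S (- u).
Proof. by rewrite -scaleN1r; apply: submoduleZ. Qed.

Lemma submoduleB u v : S u -> S v -> S (u - v).
Proof. by move=> Su Sv; apply/submoduleD/submoduleN. Qed.

Lemma submodule_sum (J : eqType) (s : seq J) (P : pred J) (F : J -> V) :
  (forall j, j \in s -> P j -> S (F j)) -> S (\sum_(j <- s | P j) F j).
Proof.
move=> SF; rewrite big_seq_cond; apply: big_ind => [|u v|j /andP[]].
- exact: submodule0.
- exact: submoduleD.
- by move=> js Pj; apply: SF.
Qed.

End Submodules.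

Lemma submodule_eq (k : fieldType) (V W : lmodType k) (f h : V -> W) :
  linear f -> linear h -> submodule (fun v => f v = h v).
Proof.
move=> fL hL; split=> [|a u v fu fv]; first by rewrite !linearP_0.
by rewrite fL hL fu fv.
Qed.

Lemma submodule_preim (k : fieldType) (V W : lmodType k) (f : V -> W)
    (S : W -> Prop) :
  linear f -> submodule S -> submodule (fun v => S (f v)).
Proof.
move=> fL [S0 SP]; split=> [|a u v Su Sv]; first by rewrite linearP_0.
by rewrite fL; apply: SP.
Qed.

(** * Actions of a presented algebra on a vector space *)

Section Action.
Variables (k : fieldType) (P : presentation k) (W : lmodType k).
Variables (S : W -> Prop) (rho : gens P -> W -> W).

(** Terms act on all of [W], but the hypotheses below only concern the submodule [S]. Typically [W]
    is a space of all functions and [S] singles out the linear, bilinear or straightening-invariant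
    ones, so that no subspace type has to be built. *)
Fixpoint tact (t : term k (gens P)) (w : W) : W :=
  match t with
  | TGen x => rho x w
  | TScal a => a *: w
  | TAdd t u => tact t w + tact u w
  | TMul t u => tact t (tact u w)
  end.

Definition pact (u : palg P) (w : W) : W := tact (repr u) w.

Hypothesis subS : submodule S.
Hypothesis rhoS : forall x w, S w -> S (rho x w).
Hypothesis rho_lin : forall x a u v, S u -> S v ->
  rho x (a *: u + v) = a *: rho x u + rho x v.
Hypothesis rho_rels : forall t u w, rels t u -> S w -> tact t w = tact u w.

Lemma tactS t w : S w -> S (tact t w).
Proof.
elim: t w => /= [x|a|t IHt u IHu|t IHt u IHu] w Sw.
- exact: rhoS.
- exact: submoduleZ.
- by apply: submoduleD => //; [apply: IHt | apply: IHu].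
- by apply/IHt/IHu.
Qed.

Lemma tact_linear t a u v : S u -> S v ->
  tact t (a *: u + v) = a *: tact t u + tact t v.
Proof.
elim: t u v => /= [x|b|t IHt t' IHt'|t IHt t' IHt'] u v Su Sv.
- exact: rho_lin.
- by rewrite scalerDr !scalerA mulrC.
- by rewrite IHt // IHt' // scalerDr addrACA.
- by rewrite IHt' // IHt //; apply: tactS.
Qed.

Lemma teq_tact t u : teq t u -> forall w, S w -> tact t w = tact u w.
Proof.
elim=> {t u} //=.
- by move=> t u tu w Sw; apply: rho_rels.
- by move=> t u _ IH w Sw; rewrite IH.
- by move=> t u v _ IH _ IH' w Sw; rewrite IH // IH'.
- by move=> t t' u u' _ IH _ IH' w Sw; rewrite IH // IH'.
- move=> t t' u u' _ IH _ IH' w Sw; rewrite IH'// IH //; exact: tactS.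
- by move=> *; rewrite addrA.
- by move=> *; rewrite addrC.
- by move=> *; rewrite scale0r add0r.
- by move=> *; rewrite scale1r.
- by move=> *; rewrite scale1r.
- by move=> *; rewrite !scale0r.
- move=> t u v w Sw.
  by rewrite -[tact u w]scale1r tact_linear ?scale1r //; apply: tactS.
- by move=> *; rewrite scalerDl.
- by move=> *; rewrite scalerA.
- move=> a t w Sw; have S0 := submodule0 subS.
  have t0 : tact t 0 = 0.
    by have := tact_linear t (-1) S0 S0; rewrite scaler0 addr0 scaleN1r addNr.
  by rewrite -[a *: w]addr0 tact_linear // t0 addr0.
Qed.

Lemma pact_pi t w : S w -> pact (\pi_(palg P) t) w = tact t w.
Proof. exact/teq_tact/repr_teq. Qed.

Lemma pactS u w : S w -> S (pact u w).
Proof. exact: tactS. Qed.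

Lemma pact_gen x w : S w -> pact (pgen x) w = rho x w.
Proof. exact: pact_pi. Qed.

Lemma pactM u v w : S w -> pact (u * v) w = pact u (pact v w).
Proof. by move=> Sw; rewrite [LHS]pact_pi. Qed.

Lemma pactD u v w : S w -> pact (u + v) w = pact u w + pact v w.
Proof. by move=> Sw; rewrite [LHS]pact_pi. Qed.

Lemma pact_scal a w : S w -> pact (pscal P a) w = a *: w.
Proof. by move=> Sw; rewrite [LHS]pact_pi. Qed.

Lemma pact1 w : S w -> pact 1 w = w.
Proof. by move=> Sw; rewrite [LHS]pact_scal // scale1r. Qed.

Lemma pactZ a u w : S w -> pact (a *: u) w = a *: pact u w.
Proof. by move=> Sw; rewrite [LHS]pactM // pact_scal //; apply: pactS. Qed.

Lemma pact_linearl w : S w -> linear (pact^~ w).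
Proof. by move=> Sw a u v; rewrite pactD // pactZ. Qed.

End Action.

(** Spanning is an induction principle over submodules and freeness is the existence of linear
    extensions: these are the two forms in which bases serve below. *)
Definition is_basis (k : fieldType) (V : lmodType k) (J : Type) (e : J -> V) :=
  (forall S, submodule S -> (forall j, S (e j)) -> forall v, S v) /\
  (forall (C : lmodType k) (F : J -> C),
     exists f : V -> C, linear f /\ forall j, f (e j) = F j).

Lemma finite_combination (k : fieldType) (V : lmodType k) (J : eqType)
    (e : J -> V) (v : V) :
    (forall S, submodule S -> (forall j, S (e j)) -> S v) ->
  exists (s : seq J) (a : J -> k), uniq s /\ v = \sum_(j <- s) a j *: e j.
Proof.
move=> vspan.
apply: (vspan (fun v => exists (s : seq J) (a : J -> k),
  uniq s /\ v = \sum_(j <- s) a j *: e j)); last first.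
  move=> j; exists [:: j]; exists (fun=> 1).
  by rewrite big_seq1 scale1r.
split=> [|c u w [s [a [us ->]]] [t [b [ut ->]]]].
  by exists [::]; exists (fun=> 0); rewrite big_nil.
(* Coefficients are extended by zero, so that both combinations range over the same duplicate-free
   support. *)
pose ext (r : seq J) (d : J -> k) j := if j \in r then d j else 0.
have extE r d : uniq r -> {subset r <= undup (s ++ t)} ->
    \sum_(j <- r) d j *: e j = \sum_(j <- undup (s ++ t)) ext r d j *: e j.
  move=> ur rst; rewrite /ext.
  transitivity (\sum_(j <- undup (s ++ t) | j \in r) d j *: e j); last first.
    by rewrite big_mkcond; apply: eq_bigr => j _; case: ifP; rewrite ?scale0r.
  rewrite -[RHS]big_filter; apply: perm_big.
  apply: uniq_perm.
    exact: ur.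
    by rewrite filter_uniq // undup_uniq.
  by move=> j; rewrite mem_filter; apply/idP/andP => [jr|[]//]; split=> //;
    apply: rst.
exists (undup (s ++ t)); exists (fun j => c * ext s a j + ext t b j).
split; first exact: undup_uniq.
rewrite (extE s a) // ?(extE t b) //.
- rewrite scaler_sumr -big_split; apply: eq_bigr => j _.
  by rewrite scalerDl scalerA.
- by move=> j jt; rewrite mem_undup mem_cat jt orbT.
- by move=> j js; rewrite mem_undup mem_cat js.
Qed.

(** Transitivity comes from the least element of [x, y, z]: if it is [x], minimality gives the
    relation; otherwise antisymmetry identifies two consecutive elements. *)
Lemma well_order_total_order (T : eqType) (R : rel T) :
  well_order R -> total_order R.
Proof.
move=> woR; have woC : wo_chain R (mem T) by move=> A _; apply: woR.
have Rrefl : reflexive R by move=> x; apply: (wo_chain_reflexive woC).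
have Ranti : antisymmetric R.
  by move=> x y; apply: (wo_chain_antisymmetric woC).
have Rtot : total R by move=> x y; apply: (wo_chainW woC).
split=> //; split=> //; split=> // y x z Rxy Ryz.
have [|m [[mA mlb] _]] := woR (mem [:: x; y; z]).
  by exists x; apply: mem_head.
move: mA mlb; rewrite !inE => /or3P[]/eqP-> mlb.
- by apply: mlb; rewrite !inE eqxx !orbT.
- have -> // : x = y; apply: Ranti; rewrite Rxy mlb // !inE eqxx ?orbT //.
- have yz : y = z by apply: Ranti; rewrite Ryz mlb // !inE eqxx ?orbT.
  by rewrite -yz.
Qed.

(* For a well-ordering of V, the vectors which are not in the span of the
   smaller ones form a basis. *)
Lemma exists_ordered_basis (k : fieldType) (V : lmodType k) :
  exists (I : choiceType) (e : I -> V) (le : rel I),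
    total_order le /\ is_basis e.
Proof.
have [R woR] := well_ordering_principle V.
have [[[Rrefl Rtrans] Ranti] Rtot] := well_order_total_order woR.
pose spanlt x y := forall S : V -> Prop,
  submodule S -> (forall z, R z x -> z != x -> S z) -> S y.
pose B : {pred V} := fun x => `[< ~ spanlt x x >].
pose I : choiceType := {x : V | x \in B}.
pose le (i j : I) := R (val i) (val j).
exists I, val, le; split.
  split=> [|i j]; last exact: Rtot.
  split; last by move=> i j /Ranti/val_inj.
  by split=> [i|j i l]; [apply: Rrefl | apply: Rtrans].
have spanB S : submodule S -> (forall j : I, S (val j)) -> forall v, S v.
  (* The least vector [m] outside [S] has all smaller vectors in [S]. If it is in [B] it is a basis
     vector, hence in [S]; if not, it lies in the span of the smaller ones, hence again in [S]. *)
  move=> subS SB v; apply: contrapT => NSv.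
  have [|m [[/asboolP NSm mlb] _]] := woR (fun x => `[< ~ S x >]).
    by exists v; apply/asboolP.
  have Sm z : R z m -> z != m -> S z.
    move=> Rzm zm; apply: contrapT => NSz.
    case/eqP: zm; apply: Ranti; rewrite Rzm mlb //.
    exact/asboolP.
  have [mB|] := boolP (m \in B); first by apply: NSm; apply: (SB (Sub m mB)).
  by move=> /asboolPn/contrapT/(_ _ subS Sm).
have freeB (s : seq I) (a : I -> k) : uniq s ->
    \sum_(i <- s) a i *: val i = 0 -> forall i, i \in s -> a i = 0.
  have [n] := ubnP (size s); elim: n s => // n IHn s szs us s0.
  have [->//|s_neq] := eqVneq s [::].
  (* The coefficient at the largest index of a relation must vanish, since otherwise that vector
     would be a combination of smaller ones. *)
  have [m ms mmax] : exists2 m, m \in s & forall i, i \in s -> le i m.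
    elim: s s_neq {IHn szs us s0} => // i s IHs _.
    have [->|/IHs[m ms mmax]] := eqVneq s [::].
      by exists i; rewrite ?mem_head // => j; rewrite inE => /eqP->;
        apply: Rrefl.
    have /orP[im|mi] := Rtot (val i) (val m).
      exists m; first by rewrite inE ms orbT.
      by move=> j; rewrite inE => /orP[/eqP->//|]; apply: mmax.
    exists i; first exact: mem_head.
    move=> j; rewrite inE => /orP[/eqP->|]; first exact: Rrefl.
    by move=> /mmax jm; apply: Rtrans mi.
  have s0' := s0; rewrite (bigD1_seq m) //= -big_filter in s0'.
  have am0 : a m = 0.
    apply: contrapT => /eqP am0; have /asboolP := valP m; apply=> S subS Sm.
    move/eqP: s0'; rewrite addr_eq0 => /eqP/(congr1 (fun v => (a m)^-1 *: v)).
    rewrite scalerA mulVf // scale1r => mE; rewrite [X in S X]mE.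
    apply: (submoduleZ subS); apply: (submoduleN subS).
    apply: (submodule_sum subS) => i; rewrite mem_filter => /andP[im si] _.
    by apply: submoduleZ => //; apply: Sm; [apply: mmax | rewrite val_eqE].
  move: s0'; rewrite am0 scale0r add0r => s0' i si.
  have [->//|im] := eqVneq i m.
  apply: (IHn [seq j <- s | j != m]) => //; last by rewrite mem_filter im.
    rewrite ltnS in szs; apply: leq_trans szs.
    rewrite size_filter -(count_predC (fun j => j != m) s) -[X in (X <
      _)%N]addn0.
    rewrite ltn_add2l -has_count; apply/hasP; exists m => //=.
    by rewrite eqxx.
  exact: filter_uniq.
split=> // C F.
(* [G] is the graph of the extension: the span in [V * C] of the pairs [(val i, F i)]. Freeness
   makes it single-valued and spanning makes it total. *)
pose G v c := forall T : V * C -> Prop, submodule T ->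
  (forall i : I, T (val i, F i)) -> T (v, c).
have subG : submodule (fun vc : V * C => G vc.1 vc.2).
  split=> [T subT _|a u v Gu Gv T subT TF]; first exact: (submodule0 subT).
  apply: (submoduleD subT (u := (a *: u.1, a *: u.2)) (v := (v.1, v.2)));
    last by apply: Gv.
  by apply: (submoduleZ subT a (u := (u.1, u.2))); apply: Gu.
have G0 c : G 0 c -> c = 0.
  move=> /finite_combination[s [a [us /= sE]]].
  have sE1 : 0 = \sum_(i <- s) a i *: val i.
    by have := congr1 fst sE; rewrite (big_morph fst (id1 := 0) (op1 := +%R)).
  have -> : c = \sum_(i <- s) a i *: F i.
    by have := congr1 snd sE; rewrite (big_morph snd (id1 := 0) (op1 := +%R)).
  rewrite big_seq big1 // => i si.
  by rewrite (freeB s a us (esym sE1)) // scale0r.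
have Gfun v c c' : G v c -> G v c' -> c = c'.
  move=> Gc Gc'; apply/eqP; rewrite -subr_eq0; apply/eqP/G0.
  have := submoduleB subG (u := (v, c)) (v := (v, c')) Gc Gc'.
  by rewrite /= subrr.
have Gtot v : exists c, G v c.
  apply: (spanB (fun v => exists c, G v c)) => [|i];
    last by exists (F i) => T _ TF; apply: TF.
  split=> [|a u w [c Gu] [d Gw]]; first by exists 0; apply: (submodule0 subG).
  by exists (a *: c + d); apply: (subG.2 a (u, c) (w, d)).
have [f fG] := choice Gtot; exists f; split=> [a u v|i].
  apply: (Gfun (a *: u + v)); first exact: fG.
  by apply: (subG.2 a (u, f u) (v, f v)).
by apply: (Gfun (val i)) => // T _; apply.
Qed.

Section LinearExtension.
Variables (k : fieldType) (V : lmodType k) (J : Type) (e : J -> V).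
Hypothesis e_basis : is_basis e.

(** For [v = \sum_j v_j e_j] this is [\sum_j v_j F_j]. Brackets of basis vectors are expanded in
    this way, without naming their coordinates. *)
Definition lin (C : lmodType k) (F : J -> C) : V -> C :=
  sval (cid (e_basis.2 C F)).

Lemma lin_linear (C : lmodType k) (F : J -> C) : linear (lin F).
Proof. by rewrite /lin; case: cid => f []. Qed.

Lemma lin_basis (C : lmodType k) (F : J -> C) j : lin F (e j) = F j.
Proof. by rewrite /lin; case: cid => f []. Qed.

Lemma lin_unique (C : lmodType k) (F : J -> C) (f : V -> C) :
  linear f -> (forall j, f (e j) = F j) -> forall v, f v = lin F v.
Proof.
move=> fL fF; apply: e_basis.1; first exact/submodule_eq/lin_linear.
by move=> j; rewrite lin_basis.
Qed.

Lemma basis_ext (C : lmodType k) (f h : V -> C) :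
  linear f -> linear h -> (forall j, f (e j) = h (e j)) ->
  forall v, f v = h v.
Proof. by move=> fL hL fh; apply: e_basis.1; first exact: submodule_eq. Qed.

Lemma eq_lin (C : lmodType k) (F G : J -> C) v :
  F =1 G -> lin F v = lin G v.
Proof. by move=> /funext->. Qed.

Lemma linD (C : lmodType k) (F G : J -> C) v :
  lin (fun j => F j + G j) v = lin F v + lin G v.
Proof.
apply/esym/(lin_unique (f := fun v => lin F v + lin G v)) => [a u w|j].
  by rewrite !lin_linear scalerDr addrACA.
by rewrite !lin_basis.
Qed.

Lemma lin_comp (C D : lmodType k) (h : C -> D) (F : J -> C) v :
  linear h -> h (lin F v) = lin (fun j => h (F j)) v.
Proof.
move=> hL; apply: (lin_unique (f := fun v => h (lin F v))) => [a u w|j].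
  by rewrite lin_linear hL.
by rewrite lin_basis.
Qed.

Lemma linZ (C : lmodType k) a (F : J -> C) v :
  lin (fun j => a *: F j) v = a *: lin F v.
Proof.
apply/esym/(lin_comp (h := fun c : C => a *: c)) => b c d.
by rewrite scalerDr !scalerA mulrC.
Qed.

(** Interchange of two sums over coordinates. *)
Lemma lin_exchange (C : lmodType k) (G : J -> J -> C) u v :
  lin (fun i => lin (G i) v) u = lin (fun j => lin (G^~ j) u) v.
Proof.
apply: (lin_unique (f := fun v => lin (fun i => lin (G i) v) u)) => [a w w'|j].
  by rewrite -linZ -linD; apply: eq_lin => i; rewrite lin_linear.
by apply: eq_lin => i; rewrite lin_basis.
Qed.

End LinearExtension.

(** * The Poincare-Birkhoff-Witt theorem *)

Section LieAlgebra.
Variables (k : fieldType) (g : lmodType k) (br : g -> g -> g).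
Hypothesis brL : lie_algebra br.

Lemma lie_linearr x : linear (br x). Proof. by case: brL. Qed.
Lemma lie_linearl y : linear (br^~ y). Proof. by case: brL. Qed.
Lemma lie_xx x : br x x = 0. Proof. by case: brL. Qed.

Lemma lieDl x y z : br (x + y) z = br x z + br y z.
Proof. exact: (linearP_D (lie_linearl z)). Qed.
Lemma lieDr x y z : br x (y + z) = br x y + br x z.
Proof. exact: (linearP_D (lie_linearr x)). Qed.
Lemma lieZr a x y : br x (a *: y) = a *: br x y.
Proof. exact: (linearP_Z (lie_linearr x)). Qed.
Lemma lieNr x y : br x (- y) = - br x y.
Proof. exact: (linearP_N (lie_linearr x)). Qed.

Lemma lie_anti x y : br x y = - br y x.
Proof.
apply/eqP; rewrite -addr_eq0; apply/eqP; have := lie_xx (x + y).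
by rewrite lieDl !lieDr !lie_xx add0r addr0.
Qed.

Lemma lie_jacobi x y z : br x (br y z) = br (br x y) z + br y (br x z).
Proof.
case: brL => _ _ _ /(_ x y z) J.
apply/eqP; rewrite -subr_eq0 opprD addrA -J.
by rewrite [br (br x y) z]lie_anti opprK (lie_anti x z) lieNr opprK addrAC.
Qed.

End LieAlgebra.

(** * Words over a totally ordered alphabet, their descents and inversions *)

Section Words.
Variables (I : eqType) (le : rel I).
Hypothesis le_total : total_order le.

(** Always taking the leftmost descent makes straightening a function; that the choice is immaterial
    is the content of [straighten_straightened]. *)
Fixpoint first_descent (w : seq I) : option (seq I * I * I * seq I) :=
  if w is x :: w' then
    if w' is y :: b then
      if le x y then
        omap (fun '(a, x', y', b') => (x :: a, x', y', b')) (first_descent w')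
      else Some ([::], x, y, b)
    else None
  else None.

Lemma first_descent_cons2 x y b : first_descent (x :: y :: b) =
  if le x y then
    omap (fun '(a, x', y', b') => (x :: a, x', y', b')) (first_descent (y :: b))
  else Some ([::], x, y, b).
Proof. by []. Qed.

Lemma first_descent_sorted w : (first_descent w == None) = sorted le w.
Proof.
elim: w => // x [|y b] // IH; rewrite first_descent_cons2 [RHS]/=.
case: (le x y) => //; rewrite andTb -[path _ _ _]/(sorted le (y :: b)) -IH.
by case: (first_descent (y :: b)) => // -[[[]]].
Qed.

Lemma first_descentP w a x y b : first_descent w = Some (a, x, y, b) ->
  w = a ++ x :: y :: b /\ ~~ le x y.
Proof.
elim: w a x y b => // z [|t c] // IH a x y b; rewrite first_descent_cons2.
case: ifP => [_|/negbT zt [<- <- <- <-]] //.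
case: (first_descent (t :: c)) IH => // -[[[a' x'] y'] b'] IH [<- <- <- <-].
by have [-> ?] := IH _ _ _ _ erefl.
Qed.

(** The three configurations of the diamond lemma: the leftmost descent is the given one, overlaps
    it in the letter [x], or lies entirely to its left. *)
Lemma first_descent_cat a x y b : ~~ le x y ->
  [\/ first_descent (a ++ x :: y :: b) = Some (a, x, y, b),
      exists a' z, [/\ a = rcons a' z, ~~ le z x &
        first_descent (a ++ x :: y :: b) = Some (a', z, x, y :: b)] |
      exists a' z t m, [/\ a = a' ++ z :: t :: m, ~~ le z t &
        first_descent (a ++ x :: y :: b) =
          Some (a', z, t, m ++ x :: y :: b)]].
Proof.
move=> xy; elim: a => [|z [|t c] IH].
- by constructor 1; rewrite /= (negPf xy).
- case zx: (le z x); last first.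
    by constructor 2; exists [::], z; rewrite /= zx.
  by constructor 1; rewrite /= zx (negPf xy).
- case zt: (le z t); last first.
    by constructor 3; exists [::], z, t, c; rewrite /= zt.
  have fdE : first_descent ((z :: t :: c) ++ x :: y :: b) =
      omap (fun '(a, x', y', b') => (z :: a, x', y', b'))
        (first_descent ((t :: c) ++ x :: y :: b)) by rewrite /= zt.
  rewrite fdE; case: IH => [->|[a' [u [-> zu ->]]]|[a' [u [v [m [-> zu ->]]]]]].
  + by constructor 1.
  + by constructor 2; exists (z :: a'), u.
  + by constructor 3; exists (z :: a'), u, v, m.
Qed.

Fixpoint inversions (w : seq I) : nat :=
  if w is x :: w' then (count (fun y => ~~ le x y) w' + inversions w')%N
  else 0%N.

(* Any word is smaller than all the longer ones, and words of the same length
   are compared by their number of inversions. *)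
Definition word_measure (w : seq I) : nat := (size w ^ 3 + inversions w)%N.

Lemma inversions_le w : (inversions w <= size w ^ 2)%N.
Proof.
elim: w => //= x w IH.
apply: leq_trans (leq_add (count_size _ _) IH) _.
by rewrite -[(size w).+1]addn1 sqrnD; lia.
Qed.

(** A word of length [n] has at most [n ^ 2] inversions, fewer than the gap between [n ^ 3] and
    [(n + 1) ^ 3]; hence the cube in the measure. *)
Lemma word_measure_size v w :
  (size v < size w)%N -> (word_measure v < word_measure w)%N.
Proof.
rewrite /word_measure => vw; have := inversions_le v.
have : ((size v).+1 ^ 3 <= size w ^ 3)%N by rewrite leq_exp2r.
by rewrite !expnS expn0; nia.
Qed.

Lemma not_le_ge x y : ~~ le x y -> le y x.
Proof. by case: le_total => _ /(_ x y)/orP[->|]. Qed.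

Lemma word_measure_swap a x y b : ~~ le x y ->
  (word_measure (a ++ y :: x :: b) < word_measure (a ++ x :: y :: b))%N.
Proof.
move=> xy; rewrite /word_measure !size_cat /= ltn_add2l.
elim: a => /= [|z a IH]; first by rewrite (negPf xy) (not_le_ge xy) /=; lia.
by rewrite !count_cat /=; lia.
Qed.

Lemma word_measure_shrink a x y z b :
  (word_measure (a ++ z :: b) < word_measure (a ++ x :: y :: b))%N.
Proof. by apply: word_measure_size; rewrite !size_cat /= !addnS. Qed.

End Words.

Section PBW.
Variables (k : fieldType) (g : lmodType k) (br : g -> g -> g).
Hypothesis brL : lie_algebra br.
Variables (I : choiceType) (e : I -> g) (le : rel I).
Hypotheses (le_total : total_order le) (e_basis : is_basis e).
Notation measure := (word_measure le).

(** * Straightening of words *)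

Section Straightening.
Variables (C : lmodType k) (tau : seq I -> C).

(** The relation [x y = y x + [x, y]] of the enveloping algebra, seen through [s] in the context
    [a .. b]. *)
Definition straightened (s : seq I -> C) (a : seq I) (x y : I) (b : seq I) :=
  s (a ++ x :: y :: b) = s (a ++ y :: x :: b) +
    lin e_basis (fun c => s (a ++ c :: b)) (br (e x) (e y)).

(** [n] is fuel. The default [0] is never reached once [n] exceeds the measure of [w], because both
    recursive calls are on words of smaller measure. *)
Fixpoint straighten_rec (n : nat) (w : seq I) : C :=
  if n is n'.+1 then
    if first_descent le w is Some (a, x, y, b) then
      straighten_rec n' (a ++ y :: x :: b) +
      lin e_basis (fun c => straighten_rec n' (a ++ c :: b)) (br (e x) (e y))
    else tau w
  else 0.

Definition straighten w := straighten_rec (measure w).+1 w.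

Lemma straighten_recE n w :
  (measure w < n)%N -> straighten_rec n w = straighten w.
Proof.
suff fuel m : (measure w < m)%N -> (measure w < n)%N ->
  straighten_rec n w = straighten_rec m w by apply: fuel.
elim: n m w => // n IH [//|m] w wm wn /=.
case D: first_descent => [[[[a x] y] b]|] //.
have [wE xy] := first_descentP D; rewrite wE in wm wn.
have swap := word_measure_swap le_total a b xy.
have shrink c := word_measure_shrink le a x y c b.
congr (_ + _); last apply: eq_lin => c.
  by apply: IH; apply: leq_trans swap _.
by apply: IH; apply: leq_trans (shrink c) _.
Qed.

Lemma straighten_sorted w : sorted le w -> straighten w = tau w.
Proof. by rewrite -first_descent_sorted /straighten /= => /eqP->. Qed.

Lemma straighten_first a x y b :
  first_descent le (a ++ x :: y :: b) = Some (a, x, y, b) ->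
  straightened straighten a x y b.
Proof.
move=> D; have [_ xy] := first_descentP D.
rewrite /straightened {1}/straighten /= D straighten_recE; last first.
  exact: word_measure_swap.
congr (_ + _); apply: eq_lin => c.
by rewrite straighten_recE // word_measure_shrink.
Qed.

Lemma straightened_sym s a x y b :
  straightened s a x y b -> straightened s a y x b.
Proof.
rewrite /straightened => ->; rewrite -addrA [br (e y) _](lie_anti brL).
by rewrite (linearP_N (lin_linear e_basis _)) subrr addr0.
Qed.

(** Induction on the measure. When [x, y] is not the leftmost descent, the leftmost one is resolved
    first and the relation is used on smaller words; overlapping descents then require the Jacobi
    identity, disjoint ones an exchange of sums. *)
Lemma straighten_straightened a x y b : straightened straighten a x y b.
Proof.
(* Only descents matter: for [x = y] the bracket vanishes, and an ordered pair is the reverse of a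
   descent. *)
suff descent n : forall a x y b, ~~ le x y ->
    (measure (a ++ x :: y :: b) < n)%N -> straightened straighten a x y b.
  have [xy|/descent-/(_ _ a b (ltnSn _))//] := boolP (le x y).
  have [->|nxy] := eqVneq x y.
    by rewrite /straightened (lie_xx brL) (linearP_0 (lin_linear _ _)) addr0.
  apply: straightened_sym; apply: descent (ltnSn _).
  apply: contra nxy => yx; apply/eqP.
  by case: le_total => -[_ anti] _; apply: anti; rewrite xy yx.
elim: n => // n IH {}a {}x {}y {}b xy.
rewrite ltnS => wn.
have IHsize a' x' y' b' :
    (size (a' ++ x' :: y' :: b') < size (a ++ x :: y :: b))%N ->
    straightened straighten a' x' y' b'.
  move=> sz; have small v : size v = size (a' ++ x' :: y' :: b') ->
      (measure v < n)%N.
    by move=> vE; apply: leq_trans wn; apply: word_measure_size; rewrite vE.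
  have [xy'|xy'] := boolP (le x' y'); last by apply: IH => //; apply: small.
  have [->|nxy] := eqVneq x' y'.
    by rewrite /straightened (lie_xx brL) (linearP_0 (lin_linear _ _)) addr0.
  apply: straightened_sym; apply: IH.
    apply: contra nxy => yx; apply/eqP.
    by case: le_total => -[_ anti] _; apply: anti; rewrite xy' yx.
  by apply: small; rewrite !size_cat.
have [/straighten_first//|[a' [z [aE zx D]]]|[a' [z [t [m [aE zt D]]]]]] :=
  first_descent_cat a b xy.
  (* the overlapping descents [z > x > y], resolved by the Jacobi identity *)
  move: D IHsize wn; rewrite aE cat_rcons /straightened => D IHsize wn.
  have zy : ~~ le z y.
    case: le_total => -[[_ tr] _] _; apply: contra xy => zy.
    exact: tr (not_le_ge le_total zx) zy.
  have cat1 c u : rcons a' c ++ u = a' ++ c :: u by rewrite cat_rcons.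
  have sw1 := word_measure_swap le_total a' (y :: b) zx.
  have sw2 := word_measure_swap le_total (rcons a' x) b zy.
  have sw3 := word_measure_swap le_total (rcons a' z) b xy.
  have sw4 := word_measure_swap le_total a' (x :: b) zy.
  rewrite !cat1 in sw2 sw3.
  have E1 := straighten_first D.
  have E2 : straightened straighten (rcons a' x) z y b.
    by apply: IH => //; rewrite cat1; apply: leq_trans sw1 wn.
  have E3 : straightened straighten a' x y (z :: b).
    apply: IH => //; apply: leq_trans wn; apply: ltn_trans sw2 _.
    exact: sw1.
  have E4 : straightened straighten a' z y (x :: b).
    by apply: IH => //; apply: leq_trans wn; apply: sw3.
  have E5 : straightened straighten (rcons a' y) z x b.
    apply: IH => //; apply: leq_trans wn; rewrite cat1.
    exact: ltn_trans sw4 sw3.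
  rewrite /straightened !cat1 in E1 E2 E3 E4 E5.
  rewrite !cat1.
  (* Moving an expanded bracket [u] past the letter [v] involves only shorter words, and costs one
     more bracket [[u, e v]]. *)
  have move_br u v : lin e_basis (fun c => straighten (a' ++ c :: v :: b)) u =
      lin e_basis (fun c => straighten (a' ++ v :: c :: b)) u +
      lin e_basis (fun c => straighten (a' ++ c :: b)) (br u (e v)).
    rewrite (lin_unique e_basis (F := fun w => lin e_basis
      (fun c => straighten (a' ++ c :: b)) (br (e w) (e v)))
      (f := fun u => lin e_basis _ (br u (e v)))) //.
      rewrite -linD; apply: eq_lin => c.
      by apply: IHsize; rewrite !size_cat /= !addnS ltnS.
    by move=> c w w'; rewrite (lie_linearl brL) lin_linear.
  have cat1f c u : (fun d => straighten (rcons a' c ++ d :: u)) =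
      (fun d => straighten (a' ++ c :: d :: u)).
    by apply/funext => d; rewrite cat1.
  rewrite !cat1f in E2 E5 *.
  rewrite E1 E2 E3 E4 E5 !move_br.
  set L := lin e_basis (fun c => straighten (a' ++ c :: b)).
  have <- : L (br (br (e z) (e x)) (e y)) + L (br (br (e x) (e y)) (e z)) =
      L (br (br (e z) (e y)) (e x)).
    rewrite -(linearP_D (lin_linear _ _)); congr L.
    rewrite [br (br (e x) _) _](lie_anti brL).
    rewrite (lie_jacobi brL (e z) (e x) (e y)) opprD addrA subrr sub0r.
    by rewrite (lie_anti brL) opprK.
  by rewrite !addrA [LHS](ACl (1*5*4*6*3*2)).
(* Disjoint descents [z, t] and [x, y]: resolving them in either order yields the same four terms,
   up to the order of the two bracket expansions. *)
move: D IHsize wn; rewrite aE -!catA /= => D IHsize wn.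
have catE u v w : a' ++ u :: v :: m ++ w = (a' ++ u :: v :: m) ++ w.
  by rewrite -catA.
have catE1 u w : a' ++ u :: m ++ w = (a' ++ u :: m) ++ w by rewrite -catA.
have sw1 := word_measure_swap le_total a' (m ++ x :: y :: b) zt.
have sw2 := word_measure_swap le_total (a' ++ z :: t :: m) b xy.
rewrite -!catE in sw2.
have E1 := straighten_first D.
have E2 : straightened straighten (a' ++ t :: z :: m) x y b.
  by apply: IH => //; rewrite -catE; apply: leq_trans wn.
have E3 : straightened straighten a' z t (m ++ y :: x :: b).
  by apply: IH => //; apply: leq_trans wn.
have E4 c : straightened straighten (a' ++ c :: m) x y b.
  by apply: IHsize; do !rewrite size_cat /=; lia.
have E5 c : straightened straighten a' z t (m ++ c :: b).
  by apply: IHsize; do !rewrite size_cat /=; lia.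
rewrite /straightened -!catE in E1 E2 E3 *; rewrite E1 E2 E3.
rewrite (eq_lin e_basis (F := fun c => straighten (a' ++ c :: m ++ _))
  (G := fun c => straighten (a' ++ c :: m ++ y :: x :: b) +
    lin e_basis (fun d => straighten (a' ++ c :: m ++ d :: b))
      (br (e x) (e y)))); last first.
  move=> c; rewrite catE1 E4 -catE1; congr (_ + _); apply: eq_lin => d.
  by rewrite -catA.
rewrite [in RHS](eq_lin e_basis (F := fun c => straighten ((a' ++ z :: _) ++ _))
  (G := fun c => straighten ((a' ++ t :: z :: m) ++ c :: b) +
    lin e_basis (fun d => straighten (a' ++ d :: m ++ c :: b))
      (br (e z) (e t)))); last first.
  by move=> c; rewrite -!catE E5.
by rewrite !linD lin_exchange !addrA [LHS](ACl (1*3*2*4)).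
Qed.
End Straightening.
End PBW.

Lemma lin0 (k : fieldType) (V : lmodType k) (J : Type) (e : J -> V)
  (e_basis : is_basis e) (C : lmodType k) v : lin e_basis (fun=> 0 : C) v = 0.
Proof.
apply/esym/(lin_unique e_basis (f := fun=> 0)) => // a u w.
by rewrite scaler0 addr0.
Qed.

Lemma uea_gen_linear (k : fieldType) (g : lmodType k) (br : g -> g -> g) :
  linear (uea_gen br).
Proof. by move=> a x y; rewrite uea_genD uea_genZ. Qed.

Lemma comm_linearl (k : fieldType) (A : algType k) (v : A) :
  linear (@commutator k A ^~ v).
Proof.
move=> a u w; rewrite /commutator mulrDl mulrDr -scalerAl -scalerAr opprD.
by rewrite scalerBr addrACA.
Qed.

Lemma comm_linearr (k : fieldType) (A : algType k) (v : A) :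
  linear (@commutator k A v).
Proof.
move=> a u w; rewrite /commutator mulrDl mulrDr -scalerAl -scalerAr opprD.
by rewrite scalerBr addrACA.
Qed.

Lemma mul_linearl (k : fieldType) (A : algType k) (v : A) :
  linear (fun u : A => u * v).
Proof. by move=> a u w; rewrite mulrDl -scalerAl. Qed.

Lemma mul_linearr (k : fieldType) (A : algType k) (v : A) :
  linear (fun u : A => v * u).
Proof. by move=> a u w; rewrite mulrDr -scalerAr. Qed.

(** Stability of [S] under left multiplication passes from generators to all terms; it is then
    applied to [1]. *)
Lemma palg_ind_gen (k : fieldType) (P : presentation k) (S : palg P -> Prop) :
  submodule S -> S 1 -> (forall x u, S u -> S (pgen x * u)) -> forall u, S u.
Proof.
move=> subS S1 SM; suff SMt t u : S u -> S (\pi_(palg P) t * u).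
  by elim/palgW=> t; rewrite -[\pi_(palg P) t]mulr1; apply: SMt.
elim: t u => [x|a|t IHt t' IHt'|t IHt t' IHt'] u Su.
- exact: SM.
- exact: (submoduleZ subS a Su).
- by rewrite -paddE mulrDl; apply: submoduleD; [|apply: IHt|apply: IHt'].
- by rewrite -pmulE -mulrA; apply/IHt/IHt'.
Qed.

(** * The sorted words as a basis of the enveloping algebra *)

Section PBW.
Variables (k : fieldType) (g : lmodType k) (br : g -> g -> g).
Hypothesis brL : lie_algebra br.
Variables (I : choiceType) (e : I -> g) (le : rel I).
Hypotheses (le_total : total_order le) (e_basis : is_basis e).
Notation measure := (word_measure le).
Notation U := (uea br).

Definition word (w : seq I) : U := \prod_(i <- w) uea_gen br (e i).

Lemma word_cons i w : word (i :: w) = uea_gen br (e i) * word w.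
Proof. exact: big_cons. Qed.

Lemma word_cat v w : word (v ++ w) = word v * word w.
Proof. exact: big_cat. Qed.

Lemma word_swap a x y b : word (a ++ x :: y :: b) = word (a ++ y :: x :: b) +
  lin e_basis (fun c => word (a ++ c :: b)) (br (e x) (e y)).
Proof.
have <- : word a * uea_gen br (br (e x) (e y)) * word b =
    lin e_basis (fun c => word (a ++ c :: b)) (br (e x) (e y)).
  apply: (lin_unique _ (f := fun v => word a * uea_gen br v * word b)).
    by move=> c u v; rewrite uea_gen_linear mul_linearr mul_linearl.
  by move=> c; rewrite word_cat word_cons mulrA.
rewrite uea_gen_br /commutator !word_cat !word_cons.
by rewrite mulrBr mulrBl !mulrA addrC subrK.
Qed.

Lemma word_span (S : U -> Prop) :
  submodule S -> (forall w, sorted le w -> S (word w)) -> forall u, S u.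
Proof.
move=> subS Ssorted.
have Sword w : S (word w).
  have [n] := ubnP (measure w); elim: n w => // n IH w; rewrite ltnS => wn.
  have := first_descent_sorted le w.
  case D: first_descent => [[[[a x] y] b]|]; last by move/esym/Ssorted.
  have [wE xy] := first_descentP D; rewrite wE in wn * => _.
  rewrite word_swap; apply: submoduleD => //.
    by apply: IH; apply: leq_trans wn; apply: word_measure_swap.
  move: (br _ _); apply: e_basis.1 => [|c].
    exact/submodule_preim/subS/lin_linear.
  by rewrite lin_basis; apply: IH; apply: leq_trans wn;
    apply: word_measure_shrink.
(* Generalizing over a left factor [word w] lets the induction absorb each new generator at the end
   of [w]. *)
suff SM u : forall w, S (word w * u) by move=> u; have := SM u [::];
  rewrite /word big_nil mul1r.
apply: (palg_ind_gen (S := fun u => forall w, S (word w * u))) u.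
- split=> [w|a u v Su Sv w]; first by rewrite mulr0; apply: submodule0.
  by rewrite mul_linearr; apply: subS.2.
- by move=> w; rewrite mulr1.
- move=> x u Su w; rewrite mulrA; move: x; apply: e_basis.1 => [|i].
    apply: (submodule_preim (f := fun x => word w * uea_gen br x * u)) => //.
    by move=> a v v'; rewrite uea_gen_linear mul_linearr mul_linearl.
  rewrite -[pgen _]/(uea_gen br (e i)).
  by have := Su (rcons w i); rewrite -cats1 word_cat word_cons [word
    [::]]big_nil mulr1.
Qed.

Section Extension.
Variables (C : lmodType k).
Implicit Types (s : seq I -> C) (w : seq I).

(** The action [(x s)(w) = s(w x)] on functions of words. On the functions compatible with
    straightening it satisfies the relations of [U(g)]. *)
Let rho (x : g) s w : C := lin e_basis (fun i => s (rcons w i)) x.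

Let invariant s : Prop := forall a x y b, straightened br e_basis s a x y b.

Let invariant_submodule : submodule invariant.
Proof.
split=> [a x y b|c s t sP tP a x y b]; rewrite /straightened.
  by rewrite [lin _ _ _]lin0 addr0.
rewrite [lin _ _ _](linD e_basis (fun i => c *: s _) (fun i => t _)) linZ.
by rewrite !fctE sP tP scalerDr addrACA.
Qed.

Let invariant_rho x s : invariant s -> invariant (rho x s).
Proof.
move=> sP a y z b; rewrite /straightened /rho lin_exchange -linD.
apply: eq_lin => i; rewrite !rcons_cat /= (sP a y z (rcons b i)).
by congr (_ + _); apply: eq_lin => c; rewrite rcons_cat.
Qed.

Let rho_linearr x c s t : rho x (c *: s + t) = c *: rho x s + rho x t.
Proof. by apply/funext => w; rewrite !fctE -linZ -linD. Qed.

Let rho_rels t u s :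
  uea_rels br t u -> invariant s ->
  tact (P := uea_presentation br) rho t s =
  tact (P := uea_presentation br) rho u s.
Proof.
case=> [x y|a x|x y] sP; apply/funext => w /=; rewrite !fctE /rho.
- exact: (linearP_D (lin_linear _ _)).
- exact: (linearP_Z (lin_linear _ _)).
rewrite scaleN1r.
rewrite [X in _ - X]lin_exchange.
move: x; apply: (basis_ext e_basis) => [c v v'|c v v'|i].
- by rewrite (lie_linearl brL) lin_linear.
- by rewrite !lin_linear scalerBr opprD addrACA.
rewrite !lin_basis.
move: y; apply: (basis_ext e_basis) => [c v v'|c v v'|j].
- by rewrite (lie_linearr brL) lin_linear.
- by rewrite !lin_linear scalerBr opprD addrACA.
rewrite !lin_basis -!cats1 -!catA /=.
have := sP w i j [::]; rewrite /straightened => ->.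
rewrite addrC addKr; apply: eq_lin => l; by rewrite cats1.
Qed.

(** Straightening extends [tau] to an invariant function [s]. Since [word w] acts on [s] by
    appending [w] to the argument, [u |-> (u s)([::])] is the required linear map. *)
Lemma pbw_extension (tau : seq I -> C) :
  exists f : U -> C, linear f /\ forall w, sorted le w -> f (word w) = tau w.
Proof.
pose s := straighten br le e_basis tau.
have sP : invariant s by move=> *; apply: straighten_straightened.
have pactW w : forall t, invariant t -> forall v,
    pact (P := uea_presentation br) rho (word w) t v = t (v ++ w).
  elim/last_ind: w => [|w i IH] t tP v; last rewrite -cats1 word_cat.
    by rewrite /word big_nil (pact1 invariant_submodule) // cats0.
  rewrite (pactM invariant_submodule) // IH;
    last by apply: (pactS invariant_submodule).
  rewrite word_cons [word [::]]big_nil mulr1 (pact_gen invariant_submodule) //.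
  by rewrite /rho lin_basis -cats1 catA.
exists (fun u => pact (P := uea_presentation br) rho u s [::]); split.
  move=> a u v; rewrite (pact_linearl invariant_submodule) //.
by move=> w sw; rewrite pactW // /s straighten_sorted.
Qed.

End Extension.

Lemma pbw_basis :
  is_basis (fun w : {w : seq I | sorted le w} => word (val w)).
Proof.
split=> [S subS Sw|C F].
  by apply: word_span => // w sw; apply: (Sw (Sub w sw)).
have [f [fL fE]] := pbw_extension
  (fun w => if insub w is Some w' then F w' else 0).
by exists f; split=> // w; rewrite fE ?valK //; apply: valP.
Qed.

End PBW.

(** * Primitive elements *)

Section TensorFunctional.
Variables (k : fieldType) (P Q : presentation k).
Notation A := (palg P).
Notation B := (palg Q).

Let bilinear (b : A * B -> k^o) : Prop :=
  (forall v, linear (fun u => b (u, v))) /\ (forall u, linear (fun v => b (u,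
    v))).

Let rho (x : A * B) (b : A * B -> k^o) (y : A * B) : k^o :=
  b (y.1 * x.1, y.2 * x.2).

Let bilinear_submodule : submodule bilinear.
Proof.
split=> [|c b b' [bl br] [bl' br']].
  by split=> [v|u] a x y; rewrite -[RHS]/(a *: (0 : k^o) + 0) scaler0 addr0.
split=> [v|u] a x y; rewrite !fctE.
  by rewrite bl bl' !scalerDr addrACA !scalerA mulrC.
by rewrite br br' !scalerDr addrACA !scalerA mulrC.
Qed.

Let bilinear_rho x b : bilinear b -> bilinear (rho x b).
Proof.
move=> [bl br]; split=> [v|u] a y z; rewrite /rho /=.
  by rewrite mul_linearl bl.
by rewrite mul_linearl br.
Qed.

Let rho_rels t u b : tensor_rels t u -> bilinear b ->
  tact (P := tensor_presentation P Q) rho t b =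
  tact (P := tensor_presentation P Q) rho u b.
Proof.
move=> tu [bl br]; apply/funext => -[y z].
case: tu => [a a' c|a c c'|d a c|d a c||a c a' c'] /=; rewrite ?fctE /rho /=.
- by rewrite mulrDr (linearP_D (bl _)).
- by rewrite mulrDr (linearP_D (br _)).
- by rewrite -scalerAr (linearP_Z (bl _)).
- by rewrite -scalerAr (linearP_Z (br _)).
- by rewrite !mulr1 scale1r.
- by rewrite !mulrA.
Qed.

(** The tensor product acts on bilinear forms by right translation of the arguments. The functional
    is obtained by acting on [(u, v) |-> f u * h v] and evaluating at [(1, 1)]. *)
Lemma tensor_functional (f : A -> k^o) (h : B -> k^o) :
  linear f -> linear h -> exists F : tensor P Q -> k^o,
    linear F /\ forall a b, F (tens a b) = f a *: h b.
Proof.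
move=> fL hL; pose b (y : A * B) : k^o := f y.1 *: h y.2.
have bP : bilinear b.
  split=> [v|u] a x y; rewrite /b /=.
    by rewrite fL scalerDl scalerA.
  by rewrite hL scalerDr !scalerA mulrC.
exists (fun t => pact (P := tensor_presentation P Q) rho t b (1, 1)); split.
  by move=> a u v; rewrite (pact_linearl bilinear_submodule).
move=> u v; rewrite (pact_gen bilinear_submodule) //.
by rewrite /rho /b /= !mul1r.
Qed.

End TensorFunctional.

(** * Splittings of a word into two complementary subwords *)

Section Splittings.
Variable I : eqType.

(** These index the terms of the coproduct of a word; repetitions are kept, since their number is
    the coefficient wanted. *)
Fixpoint splittings (w : seq I) : seq (seq I * seq I) :=
  if w is i :: w' then
    [seq (i :: s.1, s.2) | s <- splittings w'] ++
    [seq (s.1, i :: s.2) | s <- splittings w']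
  else [:: ([::], [::])].

Lemma splittingsP w s : s \in splittings w ->
  [/\ subseq s.1 w, subseq s.2 w & perm_eq (s.1 ++ s.2) w].
Proof.
elim: w s => [|i w IH] s; first by rewrite inE => /eqP->.
have subw t : subseq t w -> subseq t (i :: w).
  by move=> tw; apply: subseq_trans tw (subseq_cons _ _).
rewrite mem_cat => /orP[]/mapP[t /IH[t1 t2 pt] ->]; split.
- by rewrite /= eqxx.
- exact: subw.
- by rewrite /= perm_cons.
- exact: subw.
- by rewrite /= eqxx.
- by rewrite -cat1s perm_catCA /= perm_cons.
Qed.

Lemma count_splittings_cons i w A B :
  count_mem (A, B) (splittings (i :: w)) =
  ((if A is x :: A' then (x == i) * count_mem (A', B) (splittings w) else 0) +
   (if B is x :: B' then (x == i) * count_mem (A, B') (splittings w) else 0))%N.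
Proof.
rewrite /= count_cat !count_map; congr (_ + _)%N.
  case: A => [|x A]; first by rewrite -(count_pred0 (splittings w));
    apply: eq_count.
  have [->|/negPf xi] := eqVneq x i; rewrite ?mul1n ?mul0n.
    by apply: eq_count => s; rewrite /= !xpair_eqE eqseq_cons eqxx; case: s.
  rewrite -(count_pred0 (splittings w)); apply: eq_count => s /=.
  by rewrite xpair_eqE eqseq_cons eq_sym xi.
case: B => [|x B].
  rewrite -(count_pred0 (splittings w)); apply: eq_count => s /=.
  by rewrite xpair_eqE andbF.
have [->|/negPf xi] := eqVneq x i; rewrite ?mul1n ?mul0n.
  by apply: eq_count => s; rewrite /= !xpair_eqE eqseq_cons eqxx; case: s.
rewrite -(count_pred0 (splittings w)); apply: eq_count => s /=.
by rewrite xpair_eqE eqseq_cons [i == x]eq_sym xi andbF.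
Qed.

(** Each letter can only go to the side that [P] prescribes, so the coefficient is [1] in any
    characteristic. *)
Lemma count_splittings_filter (P : pred I) w :
  count_mem (filter P w, filter (predC P) w) (splittings w) = 1%N.
Proof.
elim: w => // i w IH; rewrite count_splittings_cons /=.
have [Pi|Pi] /= := boolP (P i).
  rewrite eqxx IH mul1n.
  case D: (filter _ w) => [//|x B]; have [xi|//] := eqVneq x i.
  have : x \in filter (predC P) w by rewrite D mem_head.
  by rewrite mem_filter xi /= Pi.
rewrite eqxx IH mul1n.
case D: (filter _ w) => [//|x B]; have [xi|//] := eqVneq x i.
have : x \in filter P w by rewrite D mem_head.
by rewrite mem_filter xi /= (negPf Pi).
Qed.

(** This is Pascal's rule, according to the side that receives the first letter. *)
Lemma count_splittings_nseq i a b :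
  count_mem (nseq a i, nseq b i) (splittings (nseq (a + b) i)) = 'C(a + b, a).
Proof.
have [n] := ubnP (a + b); elim: n a b => // n IH [|a] [|b] abn.
- by [].
- rewrite count_splittings_cons /= eqxx mul1n add0n.
  by rewrite (IH 0%N b) ?bin0 // ltnW.
- rewrite addn0 count_splittings_cons /= eqxx mul1n addn0.
  by have := IH a 0%N; rewrite addn0 => ->; rewrite ?binn //; lia.
transitivity
  ((i == i) * count_mem (nseq a i, nseq b.+1 i) (splittings (nseq (a + b.+1)
    i)) +
   (i == i) * count_mem (nseq a.+1 i, nseq b i) (splittings (nseq (a.+1 + b)
     i)))%N.
  by rewrite -[(a.+1 + b.+1)%N]/(a + b.+1).+1 addnS addSn count_splittings_cons.
by rewrite eqxx !mul1n IH ?IH ?addSn ?addnS ?binS 1?addnC //; lia.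
Qed.

End Splittings.

(** Write [n = m q] with [q] the [p]-part of [n]. Then [(1 + X) ^ n = (1 + X ^ q) ^ m], whose
    coefficient at [X ^ q] is [m], prime to [p]. *)
Lemma bin_ppart_neq0 (k : fieldType) (p : nat) (n : nat) :
  p \in [pchar k] -> (0 < n)%N -> 'C(n, p ^ logn p n)%:R != 0 :> k.
Proof.
move=> charkp n_gt0; have p_pr := pcharf_prime charkp.
have [m pm nE] := pfactor_coprime p_pr n_gt0.
set q := (p ^ logn p n)%N in nE *.
have q_gt0 : (0 < q)%N by rewrite expn_gt0 prime_gt0.
have m_gt0 : (0 < m)%N by move: n_gt0; rewrite nE muln_gt0 => /andP[].
have -> : 'C(n, q)%:R = ((1 + 'X : {poly k}) ^+ n)`_q.
  rewrite exprDn coef_sum.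
  have qn : (q < n.+1)%N by rewrite ltnS nE leq_pmull.
  rewrite (bigD1 (Ordinal qn)) //= big1 ?addr0 => [|j /eqP jq].
    by rewrite expr1n mul1r coefMn coefXn eqxx.
  rewrite expr1n mul1r coefMn coefXn; case: eqP => [qj|];
    last by rewrite mul0rn.
  by case: jq; apply: val_inj.
rewrite nE mulnC exprM exprDn_pchar; last first.
  rewrite pnatX; apply/orP; left; apply: sub_in_pnat (pnat_id p_pr) => r _.
  by rewrite inE => /eqP->; rewrite pchar_poly.
rewrite expr1n exprDn coef_sum (bigD1 (Ordinal (m_gt0 : (1 < m.+1)%N))) //=.
rewrite big1 ?addr0 => [|j /eqP j1].
  rewrite expr1n mul1r coefMn coefXn eqxx bin1 -(dvdn_pcharf charkp).
  by rewrite -prime_coprime.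
rewrite expr1n mul1r coefMn -exprM coefXn -[X in X == _]muln1 eqn_pmul2l //.
case: eqP => [j1'|]; last by rewrite mul0rn.
by case: j1; apply: val_inj.
Qed.

(** * Primitive elements of the enveloping algebra *)

Section Primitives.
Variables (k : fieldType) (p : nat).
Hypothesis charkp : p \in [pchar k].
Variables (g : lmodType k) (br : g -> g -> g).
Notation U := (uea br).

Let comultP := @comult_genP k g br.

Lemma comult_linear : linear (@comult k g br).
Proof. by move=> a u v; rewrite /comult pliftD // pliftZ. Qed.

Lemma comultM (u v : U) : comult (u * v) = comult u * comult v.
Proof. exact: pliftM. Qed.

Lemma comult_uea_gen x : comult (uea_gen br x) =
  tens (uea_gen br x) 1 + tens 1 (uea_gen br x).
Proof. exact: plift_gen. Qed.

Lemma tens_linearl (P Q : presentation k) (b : palg Q) :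
  linear (fun a : palg P => tens a b).
Proof. by move=> c a a'; rewrite tensDl tensZl. Qed.

Lemma tens_linearr (P Q : presentation k) (a : palg P) :
  linear (fun b : palg Q => tens a b).
Proof. by move=> c b b'; rewrite tensDr tensZr. Qed.

Lemma primitives_submodule : submodule (primitives br).
Proof.
apply: submodule_eq; first exact: comult_linear.
move=> a u v; rewrite tens_linearl tens_linearr scalerDr.
by rewrite addrACA.
Qed.

Lemma primitives_gen x : primitives br (uea_gen br x).
Proof. exact: comult_uea_gen. Qed.

Lemma tensXl (P Q : presentation k) (a : palg P) n :
  tens a (1 : palg Q) ^+ n = tens (a ^+ n) 1.
Proof.
elim: n => [|n IH]; first by rewrite !expr0 tens11.
by rewrite !exprS IH -tensM mulr1.
Qed.

Lemma tensXr (P Q : presentation k) (b : palg Q) n :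
  tens (1 : palg P) b ^+ n = tens 1 (b ^+ n).
Proof.
elim: n => [|n IH]; first by rewrite !expr0 tens11.
by rewrite !exprS IH -tensM mulr1.
Qed.

(** [tens u 1] and [tens 1 u] commute, so the Frobenius map is additive on them. *)
Lemma primitivesX u : primitives br u -> primitives br (u ^+ p).
Proof.
rewrite /primitives /= => uP.
have comultX n : comult (u ^+ n) = comult u ^+ n.
  elim: n => [|n IH]; first by rewrite !expr0 /comult plift1.
  by rewrite !exprS comultM IH.
have charT : p \in [pchar (tensor (uea_presentation br) (uea_presentation br))].
  by rewrite pchar_lalg.
rewrite comultX uP -(pFrobenius_autE charT) pFrobenius_autD_comm.
  by rewrite !pFrobenius_autE tensXl tensXr.
by rewrite /GRing.comm -!tensM !mulr1 !mul1r.
Qed.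

Lemma gp_set_submodule : submodule (gp_set p br).
Proof.
have [S0 SP] := gp_submod_closed p br.
split=> [|a u v Su Sv]; first exact/asboolP.
by apply/asboolP/SP; apply/asboolP.
Qed.

Lemma gp_set_genX x n : gp_set p br (uea_gen br x ^+ (p ^ n)).
Proof.
exists 1%N, (fun=> 1), (fun=> uea_gen br x ^+ (p ^ n)); split.
  by move=> _; exists x, n.
by rewrite big_ord1 scale1r.
Qed.

Lemma gp_set_ind (S : U -> Prop) : submodule S ->
  (forall x n, S (uea_gen br x ^+ (p ^ n))) ->
  forall u, gp_set p br u -> S u.
Proof.
move=> subS SX u [n [a [e [eP ->]]]]; apply: submodule_sum => // j _ _.
by apply: submoduleZ => //; have [x [m ->]] := eP j.
Qed.

Lemma gp_set_primitives u : gp_set p br u -> primitives br u.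
Proof.
apply: gp_set_ind => [|x n]; first exact: primitives_submodule.
elim: n => [|n IH]; first by rewrite expr1; apply: primitives_gen.
by rewrite expnSr exprM; apply: primitivesX.
Qed.

Hypothesis brL : lie_algebra br.
Variables (I : choiceType) (e : I -> g) (le : rel I).
Hypotheses (le_total : total_order le) (e_basis : is_basis e).
Notation word := (word br e).

Lemma comult_word w : comult (word w) =
  \sum_(s <- splittings w) tens (word s.1) (word s.2).
Proof.
elim: w => [|i w IH].
  by rewrite big_seq1 /= [word [::]]big_nil tens11 /comult plift1.
rewrite word_cons comultM IH comult_uea_gen mulrDl !mulr_sumr big_cat !big_map
  /=.
by congr (_ + _); apply: eq_bigr => s _; rewrite word_cons -tensM mul1r.
Qed.

Lemma word_nseq n i : word (nseq n i) = uea_gen br (e i) ^+ n.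
Proof. by rewrite [LHS]big_nseq -Monoid.iteropE. Qed.

(** A sorted word that is not some [e_i ^ (p ^ n)] is either empty or splits into two nonempty words
    with a multiplicity nonzero in [k]. Comparing coproducts shows that a primitive element has
    coordinate [0] there. *)
Lemma primitives_basis (S : U -> Prop) : submodule S ->
  (forall i n, S (uea_gen br (e i) ^+ (p ^ n))) ->
  forall u, primitives br u -> S u.
Proof.
move=> subS Se u uP.
have coef_ex s : exists c : U -> k^o, linear c /\
    forall w, sorted le w -> c (word w) = (w == s)%:R.
  exact: (pbw_extension brL le_total e_basis (fun w => (w == s)%:R : k^o)).
have [coef coefP] := choice coef_ex.
have coefL s : linear (coef s) by case: (coefP s).
have coefE s w : sorted le w -> coef s (word w) = (w == s)%:R.
  by move=> sw; have [_ ->] := coefP s.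
have [anti tr] : antisymmetric le /\ transitive le.
  by case: le_total => -[[]].
(* The left side is [F (comult v)] for the functional [F] attached to [A] and [B], so the identity
   can be checked on sorted words. There [(A, B)] splits only [M], as sorted words with the same
   letters are equal. *)
have split_coef A B M v : sorted le M -> perm_eq (A ++ B) M ->
    primitives br v ->
    coef A v * coef B 1 + coef A 1 * coef B v =
    (count_mem (A, B) (splittings M))%:R * coef M v.
  move=> sM ABM vP; have [F [FL FE]] := tensor_functional (coefL A) (coefL B).
  have <- : F (comult v) = coef A v * coef B 1 + coef A 1 * coef B v.
    by rewrite vP (linearP_D FL) !FE.
  move: (v); apply: (word_span le_total e_basis) => [|w sw].
    apply: submodule_eq => [a u1 u2|a u1 u2]; first by rewrite comult_linear FL.
    by rewrite coefL mulrDr /GRing.scale /= mulrCA.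
  rewrite comult_word (linearP_sum FL).
  have sortedS s : s \in splittings w ->
      F (tens (word s.1) (word s.2)) = (s == (A, B))%:R.
    move=> /splittingsP[s1 s2 _]; rewrite FE !coefE ?(subseq_sorted tr _ sw) //.
    by case: s {s1 s2} => a b /=; rewrite xpair_eqE /GRing.scale /= -natrM
      mulnb.
  rewrite big_seq (eq_bigr _ sortedS) -big_seq -natr_sum coefE // -natrM.
  congr (_%:R); rewrite -sum1_count [in RHS]big_mkcond.
  have [->|wM] := eqVneq w M.
    by rewrite muln1 big_mkcond.
  rewrite muln0 big_seq big1 // => s /splittingsP[_ _ sw'].
  case: eqP => // sE; move: sw'; rewrite sE /= => ABw.
  case/eqP: wM; apply: (sorted_eq tr anti) => //.
  by rewrite -(permPr ABM) perm_sym.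
have coef1 s : coef s 1 = (s == [::])%:R.
  by have := coefE s [::] isT; rewrite [word _]big_nil eq_sym.
have bad M : sorted le M -> (forall i n, M != nseq (p ^ n) i) -> coef M u = 0.
  move=> sM Mbad.
  have good A B : A != [::] -> B != [::] -> perm_eq (A ++ B) M ->
      (count_mem (A, B) (splittings M))%:R != 0 :> k -> coef M u = 0.
    move=> A0 B0 ABM N0; have := split_coef A B M u sM ABM uP.
    rewrite !coef1 (negPf A0) (negPf B0) mulr0 mul0r addr0 => /esym/eqP.
    by rewrite mulf_eq0 (negPf N0) => /eqP.
  case: M => [|i M] in sM Mbad good *.
    (* At the empty word the identity reads [c + c = c]. *)
    have := split_coef [::] [::] [::] u sM isT uP.
    rewrite !coef1 eqxx mulr1 !mul1r => /eqP.
    by rewrite -subr_eq0 addrK => /eqP.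
  have [allM|nallM] := boolP (all (pred1 i) M); last first.
    (* With two distinct letters, the occurrences of the first one are separated from the rest. *)
    apply: (good (filter (pred1 i) (i :: M)) (filter (predC (pred1 i)) (i ::
      M))).
    - by rewrite /= eqxx.
    - by rewrite -has_filter /= eqxx /= has_predC.
    - by rewrite perm_filterC.
    - by rewrite count_splittings_filter oner_neq0.
  have ME : i :: M = nseq (size M).+1 i.
    by congr (_ :: _); apply/all_pred1P.
  set n := (size M).+1 in ME; have n_gt0 : (0 < n)%N by [].
  (* For a power of one letter, the [p]-part [q] of the exponent is split off; [q < n] because [n]
     is not a power of [p]. *)
  set q := (p ^ logn p n)%N.
  have q_dvd : (q %| n)%N by apply: pfactor_dvdnn.
  have qn : (q < n)%N.
    rewrite ltn_neqAle dvdn_leq // andbT; apply/eqP => qn.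
    by have := Mbad i (logn p n); rewrite ME -/q qn eqxx.
  have nE : n = (q + (n - q))%N by rewrite subnKC // ltnW.
  have q_gt0 : (0 < q)%N by rewrite (dvdn_gt0 _ q_dvd).
  apply: (good (nseq q i) (nseq (n - q) i)).
  - by case: (q) q_gt0.
  - by rewrite -size_eq0 size_nseq subn_eq0 -ltnNge.
  - by rewrite -nseqD -nE ME.
  - by rewrite ME [in splittings _]nE count_splittings_nseq -nE bin_ppart_neq0.
have [wspan _] := pbw_basis brL le_total e_basis.
have [s [a [us uE]]] := finite_combination (fun T subT Tw => wspan T subT Tw u).
rewrite uE; apply: submodule_sum => // w sw _.
have aE : coef (val w) u = a w.
  rewrite uE (linearP_sum (coefL _)) (bigD1_seq w) //= big1_seq ?addr0.
    by rewrite (linearP_Z (coefL _)) coefE ?(valP w) // eqxx /GRing.scale /=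
      mulr1.
  move=> v /andP[vw _]; rewrite (linearP_Z (coefL _)) coefE ?(valP v) //.
  by rewrite val_eqE (negPf vw) scaler0.
have [[i [n wE]]|wbad] := pselect (exists i n, val w = nseq (p ^ n) i).
  by apply: submoduleZ => //; rewrite wE word_nseq.
rewrite -aE bad ?scale0r; [exact: submodule0 | exact: (valP w) |].
by move=> i n; apply/eqP => wE; case: wbad; exists i, n.
Qed.

End Primitives.

(** * Extension of a Rota-Baxter operator *)

Section RotaBaxterExtension.
Variables (k : fieldType) (g : lmodType k) (br : g -> g -> g) (R : g -> g).
Hypothesis gRB : rb_lie_algebra 1 br R.

Let brL : lie_algebra br := gRB.1.

Lemma rb_linear : linear R. Proof. by case: gRB => _ []. Qed.

Definition rb_bracket x y := br (R x) y + br x (R y) + br x y.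

Definition rb_shift x := R x + x.

Lemma rb_morph x y : R (rb_bracket x y) = br (R x) (R y).
Proof.
case: gRB => _ [RL ->]; rewrite scale1r /rb_bracket.
by rewrite !(linearP_D rb_linear).
Qed.

Lemma rb_shift_linear : linear rb_shift.
Proof. by move=> a x y; rewrite /rb_shift rb_linear scalerDr addrACA. Qed.

Lemma rb_shift_morph x y :
  rb_shift (rb_bracket x y) = br (rb_shift x) (rb_shift y).
Proof.
rewrite /rb_shift rb_morph !(lieDl brL) !(lieDr brL) /rb_bracket !addrA.
by rewrite -!addrA; congr (_ + _).
Qed.

Notation U := (uea br).
Notation UR := (uea rb_bracket).
Notation gen := (uea_gen br).
Notation genR := (uea_gen rb_bracket).

(** [UR] acts on the linear maps from [g] to [UR]. Treating all [x] at once is essential, because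
    the rule for moving [x] past [t] replaces it by [[x, R t + t]]. *)
Let act (t : g) (F : g -> UR) (x : g) : UR :=
  genR t * F x + F (br x (rb_shift t)).

Let lin_submodule : submodule (fun F : g -> UR => linear F).
Proof.
split=> [a x y|c F G FL GL a x y].
  by rewrite -[RHS]/(a *: (0 : UR) + 0) scaler0 addr0.
by rewrite !fctE FL GL !scalerDr addrACA !scalerA mulrC.
Qed.

Let act_linear t F : linear F -> linear (act t F).
Proof.
move=> FL a x y; rewrite /act FL (lie_linearl brL) FL mul_linearr scalerDr.
by rewrite addrACA.
Qed.

Let act_linearr t a F G : linear F -> linear G ->
  act t (a *: F + G) = a *: act t F + act t G.
Proof.
move=> _ _; apply/funext => x; rewrite /act !fctE mul_linearr scalerDr.
by rewrite addrACA.
Qed.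

Let act_rels t u F : uea_rels rb_bracket t u -> linear F ->
  tact (P := uea_presentation rb_bracket) act t F =
  tact (P := uea_presentation rb_bracket) act u F.
Proof.
case=> [x y|a x|x y] FL; apply/funext => z /=; rewrite !fctE /act.
- rewrite uea_genD mulrDl (linearP_D rb_shift_linear) (lieDr brL).
  by rewrite (linearP_D FL) addrACA.
- rewrite uea_genZ -scalerAl (linearP_Z rb_shift_linear) (lieZr brL).
  by rewrite (linearP_Z FL) scalerDr.
rewrite scaleN1r rb_shift_morph uea_gen_br /commutator (lie_jacobi brL).
rewrite (linearP_D FL) [br (rb_shift x) _](lie_anti brL) (linearP_N FL).
rewrite !mulrDr mulrBl !mulrA !opprD !addrA.
by rewrite [RHS](ACl (1*5*4*8*(2*7)*(3*6))) /= !subrr !addr0.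
Qed.

(* [translate x v] is the transport to [UR] of the left multiplication by [x]
   of [U], along the linear isomorphism [UR -> U] sending a product
   [t1 .. tn] to [(t1 + ad (R t1)) .. (tn + ad (R tn)) 1]. *)
Let translate (x : g) (v : UR) : UR :=
  pact (P := uea_presentation rb_bracket) act v genR x.

Let genR_linear : linear genR := @uea_gen_linear k g rb_bracket.

Let translate_linearl v : linear (translate^~ v).
Proof. exact: (pactS (P := uea_presentation rb_bracket) lin_submodule
  act_linear v genR_linear). Qed.

Let translate_linearr x : linear (translate x).
Proof.
move=> a u v; rewrite /translate.
by rewrite (pact_linearl (P := uea_presentation rb_bracket) lin_submodule
  act_linear
  act_linearr act_rels).
Qed.

Let translate1 x : translate x 1 = genR x.
Proof.
by rewrite /translate (pact1 (P := uea_presentation rb_bracket) lin_submodule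
  act_linear
  act_linearr act_rels).
Qed.

Let translateM x t v : translate x (genR t * v) =
  genR t * translate x v + translate (br x (rb_shift t)) v.
Proof.
rewrite /translate (pactM (P := uea_presentation rb_bracket) lin_submodule
  act_linear
  act_linearr act_rels) //.
rewrite (pact_gen (P := uea_presentation rb_bracket) lin_submodule act_linear
  act_linearr act_rels) //.
exact: (pactS (P := uea_presentation rb_bracket) lin_submodule act_linear).
Qed.

(** This makes [translate] a representation of [g], so that [U] acts on [UR]. *)
Let translate_comm x y v : translate (br x y) v =
  translate x (translate y v) - translate y (translate x v).
Proof.
move: v x y; apply: (palg_ind_gen (S := fun v => forall x y,
  translate (br x y) v =
  translate x (translate y v) - translate y (translate x v))).
- split=> [x y|a u v IHu IHv x y].
    by rewrite !(linearP_0 (translate_linearr _)) subrr.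
  by rewrite !translate_linearr IHu IHv scalerBr opprD addrACA.
- move=> x y; rewrite !translate1.
  have tgen z t : translate z (genR t) =
      genR t * genR z + genR (br z (rb_shift t)).
    by rewrite -[genR t]mulr1 translateM mulr1 !translate1.
  rewrite !tgen opprD addrACA -[_ * _ - _]opprB.
  rewrite -/(commutator (genR x) (genR y)) -uea_gen_br.
  rewrite -!(linearP_N genR_linear) -!(linearP_D genR_linear); congr genR.
  rewrite /rb_bracket /rb_shift [br y _](lie_anti brL) opprK.
  rewrite (lieDl brL) (lieDr brL) !opprD !addrA.
  by rewrite [RHS](ACl ((1*6)*(2*4)*(3*5)*7)) /= !addNr !add0r.
- move=> t v IH x y; rewrite -[pgen t]/(genR t) !translateM.
  have -> : br (br x y) (rb_shift t) =
      br x (br y (rb_shift t)) - br y (br x (rb_shift t)).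
    by rewrite (lie_jacobi brL x) addrK.
  rewrite !(linearP_D (translate_linearr _)) !translateM.
  move: (br x (rb_shift t)) (br y (rb_shift t)) => X Y.
  rewrite (linearP_B (translate_linearl _)) !IH mulrBr !opprD !opprK.
  by rewrite !addrA [LHS](ACl (1*6*3*2*4*5)).
Qed.

Let translate_rels t u v : uea_rels br t u -> True ->
  tact (P := uea_presentation br) translate t v =
  tact (P := uea_presentation br) translate u v.
Proof.
case=> [x y|a x|x y] _ /=.
- exact: (linearP_D (translate_linearl _)).
- exact: (linearP_Z (translate_linearl _)).
- by rewrite scaleN1r translate_comm.
Qed.

Let full_submodule : submodule (fun _ : UR => True).
Proof. by []. Qed.

(** As [translate] transports left multiplication, acting on [1] transports [u] itself from [U] to
    [UR]. *)
Let psi (u : U) : UR := pact (P := uea_presentation br) translate u 1.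

Let psi_linear : linear psi.
Proof.
by apply: (pact_linearl (P := uea_presentation br) full_submodule _ _
  translate_rels) => // *;
  apply: translate_linearr.
Qed.

Let psi1 : psi 1 = 1.
Proof.
by apply: (pact1 (P := uea_presentation br) full_submodule _ _ translate_rels)
  => // *;
  apply: translate_linearr.
Qed.

Let psiM x u : psi (gen x * u) = translate x (psi u).
Proof.
rewrite /psi (pactM (P := uea_presentation br) full_submodule _ _
  translate_rels) //; last first.
  by move=> *; apply: translate_linearr.
rewrite (pact_gen (P := uea_presentation br) full_submodule _ _ translate_rels)
  // => *.
exact: translate_linearr.
Qed.

(** Left multiplication by [x] in [UR] corresponds in [U] to [x + ad (R x)], which is left
    multiplication by [x + R x] minus right multiplication by [R x]; here the latter is isolated. *)
Let psi_mulr x u :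
  psi (u * gen (R x)) = translate (rb_shift x) (psi u) - genR x * psi u.
Proof.
move: u; apply: palg_ind_gen => [||y u].
- apply: submodule_eq => [a u v|a u v].
    by rewrite mul_linearl psi_linear.
  by rewrite psi_linear translate_linearr mul_linearr scalerBr opprD addrACA.
- rewrite mul1r -[gen _]mulr1 psiM psi1 !translate1 mulr1.
  by rewrite -(linearP_B genR_linear) /rb_shift addrK.
- rewrite -mulrA -[pgen y]/(gen y) !psiM => ->.
  rewrite (linearP_B (translate_linearr _)) translateM translate_comm.
  by rewrite !opprD opprK !addrA [LHS](ACl ((1*3)*4*2)) /= subrr add0r.
Qed.

Let Rhat : UR -> U := plift (P := uea_presentation rb_bracket) (fun x => gen (R
  x)).

Let Rhat_rels t u : uea_rels rb_bracket t u ->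
  teval (fun x => gen (R x)) t = teval (fun x => gen (R x)) u.
Proof.
apply: uea_relsP => [x y|a x|x y].
- by rewrite (linearP_D rb_linear) uea_genD.
- by rewrite (linearP_Z rb_linear) uea_genZ.
- by rewrite rb_morph uea_gen_br.
Qed.

Let Rhat_linear : linear Rhat.
Proof. by move=> a u v; rewrite /Rhat pliftD ?pliftZ //; apply: Rhat_rels. Qed.

(** By [psi_mulr], [psi] sends [x u + [R x, u]] to [genR x * psi u], and [Rhat] is
    multiplicative. *)
Lemma rb_extension_exists : exists RU, rb_extension br R RU.
Proof.
exists (fun u => Rhat (psi u)).
have RU1 : Rhat (psi 1) = 1 by rewrite psi1 [LHS]plift1 //; apply: Rhat_rels.
have RUg x : Rhat (psi (gen x)) = gen (R x).
  rewrite -[gen x]mulr1 psiM psi1 translate1.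
  by rewrite [LHS]plift_gen //; apply: Rhat_rels.
split=> // [a u v|x u]; first by rewrite psi_linear Rhat_linear.
rewrite RUg; apply/eqP; rewrite eq_sym subr_eq -(linearP_D Rhat_linear).
rewrite -(linearP_D psi_linear) /commutator addrA (linearP_B psi_linear).
rewrite psi_mulr (linearP_D psi_linear) !psiM /rb_shift.
rewrite (linearP_D (translate_linearl _)) opprB addrCA addrA.
rewrite [translate (R x) _ + _]addrC addrK; apply/eqP/esym.
by rewrite /Rhat pliftM ?plift_gen //; apply: Rhat_rels.
Qed.

Lemma comm_genM x y (u : U) : commutator (gen x) (gen y * u) =
  gen (br x y) * u + gen y * commutator (gen x) u.
Proof.
rewrite uea_gen_br /commutator mulrBl mulrBr !mulrA.
by rewrite addrA subrK.
Qed.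

Lemma comm_gen_prod (S : U -> Prop) a (s : seq g) : submodule S ->
  (forall t, size t = size s -> S (\prod_(x <- t) gen x)) ->
  S (commutator (gen a) (\prod_(x <- s) gen x)).
Proof.
elim: s S => [|x s IH] S subS Ss.
  by rewrite big_nil /commutator mulr1 mul1r subrr; apply: submodule0.
rewrite big_cons comm_genM; apply: submoduleD => //.
  by have := Ss (br a x :: s) erefl; rewrite big_cons.
apply: (IH (fun u => S (gen x * u)));
  first exact/submodule_preim/subS/mul_linearr.
by move=> t st; have := Ss (x :: t); rewrite /= st big_cons; apply.
Qed.

(** Induction on the length of a product of generators: the recursion expresses the value at [x * y]
    by the values at [y] and at [[R x, y]], a sum of products as long as [y]. *)
Lemma rb_extension_unique RU RU' :
  rb_extension br R RU -> rb_extension br R RU' -> RU = RU'.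
Proof.
move=> [RUL RUg RU1 RUM] [RUL' RUg' RU1' RUM'].
have subS : submodule (fun u => RU u = RU' u) by apply: submodule_eq.
have RUprod (s : seq g) : RU (\prod_(x <- s) gen x) = RU' (\prod_(x <- s) gen
  x).
  have [n] := ubnP (size s); elim: n s => // n IH [|x s] sn.
    by rewrite big_nil RU1 RU1'.
  rewrite big_cons RUM RUM' RUg RUg' IH //; congr (_ - _).
  by apply: (comm_gen_prod (S := fun u => RU u = RU' u)) => // t ts; apply: IH;
    rewrite ts.
apply/funext => u.
suff H : forall s : seq g, RU (\prod_(x <- s) gen x * u) = RU' (\prod_(x <- s)
  gen x * u).
  by have := H [::]; rewrite big_nil mul1r.
move: u; apply: (palg_ind_gen (S := fun u => forall s : seq g,
  RU (\prod_(x <- s) gen x * u) = RU' (\prod_(x <- s) gen x * u))).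
- split=> [s|a u v IHu IHv s]; first by rewrite mulr0 (submodule0 subS).
  by rewrite mul_linearr RUL RUL' IHu IHv.
- by move=> s; rewrite mulr1.
- move=> x u IH s; rewrite mulrA -[pgen x]/(gen x).
  by have := IH (rcons s x); rewrite -cats1 big_cat big_seq1.
Qed.

End RotaBaxterExtension.

(** * Jacobson's formula *)

Section PowerOfAd.
Variables (B : nzRingType) (p : nat).
Hypothesis charBp : p \in [pchar B].
Variables a b : B.
(** For [a = b] this is the usual [ad], as in Jacobson's formula; distinct [a] and [b] occur in
    [rb_pth_power]. *)
Let ad (w : B) := a * w - w * b.

Lemma iter_ad w n : iter n ad w =
  \sum_(j < n.+1) (a ^+ (n - j) * w * b ^+ j) * ((-1) ^+ j *+ 'C(n, j)).
Proof.
elim: n => [|n IH].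
  by rewrite big_ord1 /= !expr0 mulr1 mul1r mulr1.
have signC j (m : nat) (v : B) : v * ((-1) ^+ j *+ m) = ((-1) ^+ j *+ m) * v.
  rewrite mulrnAr mulrnAl; congr (_ *+ _).
  by rewrite -signr_odd mulr_sign; case: odd;
    rewrite ?mulrN1 ?mulr1 ?expr1 ?expr0.
rewrite iterS IH /ad mulr_sumr mulr_suml.
rewrite [in RHS]big_ord_recl /= subn0 expr0 bin0 !mulr1.
under [X in _ = _ + X]eq_bigr => j _ do
  rewrite /bump add1n binS mulrnDr mulrDr subSS.
rewrite big_split /=.
rewrite [X in X - _]big_ord_recl /= subn0 expr0 bin0 !mulr1 -!addrA.
congr (_ + _); first by rewrite mulrA -exprS.
congr (_ + _); last first.
  rewrite -sumrN; apply: eq_bigr => j _.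
  rewrite exprSr exprS mulN1r mulNrn mulrN; congr (- _).
  by rewrite -!mulrA signC !mulrA.
rewrite [RHS]big_ord_recr /= bin_small // mulr0n mulr0 addr0.
apply: eq_bigr => j _; rewrite /bump add1n.
by rewrite !mulrA -exprS; congr (a ^+ _ * _ * _ * _); have := ltn_ord j; lia.
Qed.

Lemma bin_pred_pchar j : (j < p)%N -> 'C(p.-1, j)%:R = (-1) ^+ j :> B.
Proof.
have p_gt0 := prime_gt0 (pcharf_prime charBp).
elim: j => [|j IH] jp; first by rewrite bin0.
have : 'C(p, j.+1)%:R = 0 :> B by apply: bin_lt_pcharf_0; rewrite ?jp.
rewrite -{1}(prednK p_gt0) binS natrD IH 1?ltnW // => /eqP.
by rewrite addr_eq0 exprS mulN1r => /eqP.
Qed.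

(** Modulo [p] the binomials ['C(p.-1, j)] are [(-1) ^ j], cancelling the signs of the expansion. *)
Lemma iter_ad_pred w : iter p.-1 ad w =
  \sum_(j < p.-1.+1) a ^+ (p.-1 - j) * w * b ^+ j.
Proof.
have p_gt0 := prime_gt0 (pcharf_prime charBp).
rewrite iter_ad; apply: eq_bigr => j _.
rewrite -mulr_natr bin_pred_pchar -?expr2 ?sqrr_sign ?mulr1 //.
by rewrite -[X in (_ < X)%N](prednK p_gt0).
Qed.

Lemma ad_sum w n : ad (\sum_(j < n.+1) a ^+ (n - j) * w * b ^+ j) =
  a ^+ n.+1 * w - w * b ^+ n.+1.
Proof.
rewrite /ad mulr_sumr mulr_suml [X in X - _]big_ord_recl big_ord_recr /=.
rewrite subn0 subnn !expr0 mulr1 mul1r mulrA -exprS -mulrA -exprSr.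
rewrite opprD [X in _ + X]addrC addrACA -sumrB big1 ?addr0 // => j _.
rewrite /bump /= add1n !mulrA -exprS.
rewrite (_ : (n - j.+1).+1 = n - j)%N; last by have := ltn_ord j; lia.
by rewrite exprSr mulrA subrr.
Qed.

Lemma iter_ad_p w : iter p ad w = a ^+ p * w - w * b ^+ p.
Proof.
have p_gt0 := prime_gt0 (pcharf_prime charBp).
by rewrite -(prednK p_gt0) iterS iter_ad_pred ad_sum.
Qed.

End PowerOfAd.

Section Jacobson.
Variables (k : fieldType) (p : nat).
Hypothesis charkp : p \in [pchar k].
Variable A : algType k.
Notation comm := (@commutator k A).

Lemma iter_comm_p (x y : A) : iter p (comm x) y = comm (x ^+ p) y.
Proof.
have charA : p \in [pchar A] by rewrite pchar_lalg.
exact: (iter_ad_p charA).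
Qed.

Lemma deriv_exp_comm (B : nzRingType) (z : {poly B}) n :
  (z ^+ n)^`() = \sum_(j < n) z ^+ (n.-1 - j) * z^`() * z ^+ j.
Proof.
elim: n => [|n IH]; first by rewrite expr0 derivC big_ord0.
rewrite exprSr derivM IH big_ord_recl /= subn0 expr0 mulr1 addrC; congr (_ + _).
rewrite mulr_suml; apply: eq_bigr => j _; rewrite /bump /= add1n -mulrA -exprSr.
by congr (z ^+ _ * _ * _); have := ltn_ord j; lia.
Qed.

(** Let [z = x t + y]. The derivative of [z ^ p] is [\sum_j z ^ (p - 1 - j) x z ^ j = (ad z) ^ (p -
    1) x], which identifies the middle coefficients of [z ^ p] with the [jacobson_s]; then
    [t = 1]. *)
Lemma jacobson_formula (x y : A) : (x + y) ^+ p =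
  x ^+ p + y ^+ p + \sum_(1 <= i < p) jacobson_s p comm i x y.
Proof.
have p_pr := pcharf_prime charkp; have p_gt0 := prime_gt0 p_pr.
have charP : p \in [pchar {poly A}] by rewrite pchar_poly pchar_lalg.
pose z : {poly A} := x%:P * 'X + y%:P.
have zM0 q : (z * q)`_0 = y * q`_0.
  by rewrite coef0M coefD coefMX /= coefC add0r.
have zMS q i : (z * q)`_i.+1 = x * q`_i + y * q`_i.+1.
  by rewrite mulrDl coefD coefCM -mulrA -commr_polyX mulrA coefMX /= coefCM.
have Mz0 q : (q * z)`_0 = q`_0 * y.
  by rewrite coef0M coefD coefMX /= coefC add0r.
have MzS q i : (q * z)`_i.+1 = q`_i * x + q`_i.+1 * y.
  by rewrite mulrDr coefD coefMC mulrA coefMX /= coefMC.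
have adE n i : (iter n (fun w => z * w - w * z) x%:P)`_i =
    iter n (ad_txy comm x y) (fun n => if n == 0%N then x else 0) i.
  elim: n i => [|n IH] i; first by rewrite /= coefC; case: eqP.
  rewrite !iterS coefB {1}/ad_txy; case: i => [|i]; rewrite -!IH.
    by rewrite zM0 Mz0 add0r.
  by rewrite zMS MzS /commutator opprD addrACA.
have z0 n : (z ^+ n)`_0 = y ^+ n.
  elim: n => [|n IH]; first by rewrite !expr0 coefC.
  by rewrite !exprS zM0 IH.
have ztop n i : (n <= i)%N -> (z ^+ n)`_i = if i == n then x ^+ n else 0.
  elim: n i => [|n IH] i; first by rewrite !expr0 coef1; case: i.
  case: i => // i ni; rewrite exprS zMS !IH ?(ltnW (ni : n < i.+1)%N) // eqSS.
  by rewrite (gtn_eqF (ni : n < i.+1)%N) mulr0 addr0; case: eqP;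
    rewrite ?mulr0 ?exprS.
have z1 n : (x + y) ^+ n = \sum_(i < n.+1) (z ^+ n)`_i.
  elim: n => [|n IH]; first by rewrite big_ord1 !expr0 coef1.
  rewrite exprS IH mulrDl !mulr_sumr exprS [RHS]big_ord_recl /= zM0.
  under [X in _ = _ + X]eq_bigr => i _ do rewrite /bump /= add1n zMS.
  rewrite big_split /= addrCA; congr (_ + _).
  rewrite [X in _ = _ + X]big_ord_recr /= (ztop _ _ (leqnSn n)) (gtn_eqF (ltnSn
    n)) mulr0 addr0.
  by rewrite big_ord_recl.
have derivE i : (z ^+ p)`_i.+1 *+ i.+1 =
    iter p.-1 (ad_txy comm x y) (fun n => if n == 0%N then x else 0) i.
  rewrite -adE (iter_ad_pred charP) -coef_deriv -{1}(prednK p_gt0).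
  rewrite deriv_exp_comm /= derivD derivM derivX !derivC mul0r add0r mulr1
    addr0.
  by [].
have coefE i : (0 < i < p)%N -> (z ^+ p)`_i = jacobson_s p comm i x y.
  case: i => // i /andP[_ ip]; rewrite /jacobson_s -derivE -scaler_nat scalerA.
  by rewrite mulVf ?scale1r // -(dvdn_pcharf charkp) gtnNdvd.
rewrite z1 -(big_mkord xpredT (fun i => (z ^+ p)`_i)) big_nat_recr //=.
rewrite big_ltn // z0 ztop // eqxx addrC addrA; congr (_ + _).
by apply: eq_big_nat => i; apply: coefE.
Qed.

End Jacobson.

(** * The terms of Jacobson's formula as sums over compositions *)

Section JacobsonExpansion.
Variables (k : fieldType) (L : lmodType k) (br : L -> L -> L).
Hypothesis brL : lie_algebra br.
Variables x y : L.
Let D i := iter i (br y) x.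

(* [nested r j w] is the sum, over the compositions [al] of [j] of length [r],
   of the [comp_coef al *: [D (al_1 - 1), [.., [D (al_r - 1), w]..]]], computed
   by splitting off the last part. *)
Fixpoint nested (r j : nat) (w : L) : L :=
  match r, j with
  | 0, 0 => w
  | r'.+1, m.+1 =>
    \sum_(i < m.+1) 'C(m, i)%:R *: nested r' (m - i) (br (D i) w)
  | _, _ => 0
  end.

(** The choice [Y i = [D i, w]] gives [nested r.+1 m.+1 w], and [Y = D] gives the coefficient of
    [t ^ r] in [(ad (t x + y)) ^ m x]. *)
Let G r m (Y : nat -> L) := \sum_(i < m.+1) 'C(m, i)%:R *: nested r (m - i) (Y
  i).

Let nested_linear r j : linear (nested r j).
Proof.
elim: r j => [|r IH] [|m] //= a u v; rewrite ?scaler0 ?addr0 //.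
rewrite scaler_sumr -big_split; apply: eq_bigr => i _ /=.
by rewrite (lie_linearr brL) IH scalerDr !scalerA mulrC.
Qed.

Let GB r m Y Z : G r m (fun i => Y i - Z i) = G r m Y - G r m Z.
Proof.
rewrite /G -sumrB; apply: eq_bigr => i _.
by rewrite (linearP_B (nested_linear _ _)) scalerBr.
Qed.

Let nested_pred r := if r is r'.+1 then nested r' else fun _ _ => 0.

(** Pascal's rule on ['C(m.+1, i)]. The recurrence of [nested] at [r] is a hypothesis because its
    own proof at [r.+1] goes through this lemma. *)
Let G_step r m Y :
  (forall j w, nested r j.+1 w = br x (nested_pred r j w) +
    (br y (nested r j w) - nested r j (br y w))) ->
  G r m.+1 Y =
    br x (\sum_(i < m.+1) 'C(m, i)%:R *: nested_pred r (m - i) (Y i)) +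
    (br y (G r m Y) - G r m (fun i => br y (Y i))) + G r m (fun i => Y i.+1).
Proof.
move=> nestedS; rewrite /G [LHS]big_ord_recl /= bin0 scale1r subn0.
under [X in _ + X]eq_bigr => i _ do
  rewrite /bump /= add1n binS natrD scalerDl subSS.
rewrite big_split /= addrA; congr (_ + _).
transitivity (\sum_(i < m.+2) 'C(m, i)%:R *: nested r (m.+1 - i) (Y i)).
  by rewrite [RHS]big_ord_recl /= bin0 scale1r subn0.
rewrite big_ord_recr /= bin_small // scale0r addr0.
rewrite !(linearP_sum (lie_linearr brL _)) -sumrB -big_split.
apply: eq_bigr => i _ /=; rewrite subSn ?nestedS; last by rewrite -ltnS.
by rewrite !(lieZr brL) -scalerBr -scalerDr.
Qed.

(** For the operators [N_j = \sum_r t ^ r nested r j] this is [N_(j+1) = t (ad x) N_j +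
    [ad y, N_j]]. It yields [(t ad x + ad y) ^ n = \sum_i 'C(n, i) N_(n-i) (ad y) ^ i], whose value
    at [x] is [iter_ad_txy]. *)
Let nestedS r j w : nested r j.+1 w = br x (nested_pred r j w) +
  (br y (nested r j w) - nested r j (br y w)).
Proof.
elim: r j w => [|r IH] j w.
  rewrite /= (linearP_0 (lie_linearr brL x)) add0r; case: j => [|j] /=.
    by rewrite subrr.
  by rewrite (linearP_0 (lie_linearr brL y)) subrr.
have nestedSG m v : nested r.+1 m.+1 v = G r m (fun i => br (D i) v) by [].
rewrite nestedSG; case: j => [|m].
  rewrite /G big_ord1 /= bin0 scale1r (linearP_0 (lie_linearr brL y)) subrr
    addr0.
  by case: (r) => //=; rewrite (linearP_0 (lie_linearr brL x)).
rewrite G_step // !nestedSG -!addrA; congr (_ + (_ + _)).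
  congr (br x _); case: (r) => //=.
  by rewrite big1 // => i _; rewrite scaler0.
rewrite addrC -GB -[RHS]add0r -[X in _ = X - _](subrr (G r m (fun=> 0))).
rewrite -GB -GB; congr (G r m _); apply/funext => i.
rewrite subrr sub0r.
by rewrite [br y (br _ _)](lie_jacobi brL) opprD addrA subrr sub0r.
Qed.

Let iter_ad_txy n r : iter n (ad_txy br x y) (fun i => if i == 0%N then x else
  0) r =
  G r n D.
Proof.
elim: n r => [|n IH] r.
  by rewrite /G big_ord1 /= bin0 scale1r; case: r.
rewrite iterS {1}/ad_txy G_step; last exact: nestedS.
rewrite -addrA addrNK IH; congr (_ + _).
case: r => [|r]; last by rewrite IH.
by rewrite big1 ?(linearP_0 (lie_linearr brL x)) // => i _; rewrite scaler0.
Qed.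

Variable p : nat.

(** The total [n] varies while the bound [p] on the parts is fixed, so that removing the last part
    stays within the same type of tuples. *)
Let is_comp (n r : nat) (al : r.-tuple 'I_p.+1) :=
  all (fun i : 'I_p.+1 => (0 < i)%N) al && (sumn [seq val i | i <- al] == n).

Let comp_sum (n r : nat) (F : seq nat -> L) :=
  \sum_(al : r.-tuple 'I_p.+1 | is_comp n al)
    (comp_coef [seq val i | i <- al])%:R *: F [seq val i | i <- al].

Lemma comp_coef_rcons s m : comp_coef (rcons s m) =
  (comp_coef s * 'C((sumn s + m).-1, m.-1))%N.
Proof.
rewrite /comp_coef size_rcons big_ord_recr /=; congr (_ * 'C(_.-1, _.-1))%N.
- apply: eq_bigr => i _; rewrite -cats1 takel_cat // nth_cat.
  by rewrite ltn_ord.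
- by rewrite -[(size s).+1](size_rcons s m) take_size sumn_rcons.
- by rewrite nth_rcons ltnn eqxx.
Qed.

Lemma big_tuple_rcons (T : finType) r (F : r.+1.-tuple T -> L) :
  \sum_(al : r.+1.-tuple T) F al =
  \sum_(i : T) \sum_(al : r.-tuple T) F [tuple of rcons al i].
Proof.
rewrite pair_big /= (reindex (fun ia : T * r.-tuple T => [tuple of rcons ia.2
  ia.1])) //=.
apply/onW_bij/inj_card_bij; last first.
  by rewrite card_prod !card_tuple expnS.
by move=> [i al] [j be] /(congr1 val)/= /rcons_inj[/val_inj-> ->].
Qed.

(** The compositions are sorted by their last part [i + 1], whose factor in [comp_coef] is
    ['C(n, i)]. *)
Let comp_sum_rec n r F : (n < p)%N -> comp_sum n.+1 r.+1 F =
  \sum_(i < n.+1) 'C(n, i)%:R *: comp_sum (n - i)%N r (fun s => F (rcons s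
    i.+1)).
Proof.
move=> np; rewrite /comp_sum big_mkcond big_tuple_rcons.
rewrite big_ord_recl [X in X + _]big1 ?add0r; last first.
  by move=> al _; rewrite /is_comp /= all_rcons.
rewrite (big_ord_widen p (fun i => 'C(n, i)%:R *:
  \sum_(al : r.-tuple 'I_p.+1 | is_comp (n - i)%N al)
    (comp_coef [seq val i | i <- al])%:R *:
      F (rcons [seq val i | i <- al] i.+1))) //.
rewrite [RHS]big_mkcond; apply: eq_bigr => i _ /=.
rewrite -big_mkcond /=; case: ifP => [iN|/negbT iN]; last first.
  rewrite big1 // => al; rewrite /is_comp /= all_rcons map_rcons sumn_rcons.
  by move=> /andP[_ /eqP/= E]; move: iN E; rewrite /bump /=; lia.
rewrite scaler_sumr; apply: eq_big => al.
  rewrite /is_comp /= all_rcons map_rcons sumn_rcons /= /bump /= add1n;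
    congr (_ && _).
  by lia.
move=> /andP[_ /eqP]; rewrite /= map_rcons sumn_rcons /= /bump /= add1n => E.
rewrite comp_coef_rcons natrM scalerA; congr (_ *: _); rewrite mulrC.
by congr ('C(_, _)%:R * _); rewrite E.
Qed.

Let comp_sum0 j F : comp_sum j 0 F = if j == 0%N then F [::] else 0.
Proof.
rewrite /comp_sum big_mkcond (big_pred1 [tuple]) => [|al]; last first.
  by apply/esym/eqP/val_inj; case: al => -[].
rewrite /is_comp /= eq_sym; case: eqP => // _.
by rewrite /comp_coef big_ord0 scale1r.
Qed.

Let comp_sum0S r F : comp_sum 0 r.+1 F = 0.
Proof.
rewrite /comp_sum big1 // => al /andP[]; case/tupleP: al => i al /=.
by case: (nat_of_ord i).
Qed.

Let nestedE r j w : (j <= p)%N -> nested r j w =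
  comp_sum j r (foldr (fun i v => br (D i.-1) v) w).
Proof.
elim: r j w => [|r IH] [|m] w jp; rewrite ?comp_sum0 ?comp_sum0S //.
rewrite comp_sum_rec // [LHS]/=; apply: eq_bigr => i _.
rewrite IH; last by rewrite (leq_trans (leq_subr _ _)) // ltnW.
congr (_ *: comp_sum _ _ _); apply/funext => s.
by rewrite foldr_rcons.
Qed.

Lemma jacobson_s_compositions r : (0 < r < p)%N ->
  jacobson_s p br r x y = r%:R^-1 *:
    \sum_(al : r.-tuple 'I_p.+1 | is_composition al)
      (comp_coef [seq val i | i <- al])%:R *:
        iter_br br [seq D (val i).-1 | i <- al].
Proof.
case: r => // r /andP[_ rp]; rewrite /jacobson_s iter_ad_txy; congr (_ *: _).
have p_gt0 : (0 < p)%N by apply: leq_trans rp.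
have iter_brE s m : iter_br br (rcons [seq D i.-1 | i <- s] (D m)) =
    foldr (fun i v => br (D i.-1) v) (D m) s.
  elim: s => //= i s <-; by case: s.
(* The last part [i + 1] of a composition of [p] provides the innermost entry [D i], and the
   remaining parts sum to [p - 1 - i]. *)
transitivity (comp_sum p r.+1 (fun s => iter_br br [seq D i.-1 | i <- s])).
  have -> : comp_sum p = comp_sum p.-1.+1 by rewrite prednK.
  rewrite comp_sum_rec; last by rewrite prednK.
  rewrite /G; apply: eq_bigr => i _.
  rewrite nestedE; last by rewrite (leq_trans (leq_subr _ _)) // leq_pred.
  congr (_ *: comp_sum _ _ _); apply/funext => s.
  by rewrite map_rcons iter_brE.
by apply: eq_bigr => al _; rewrite -map_comp.
Qed.

End JacobsonExpansion.

(** * The universal envelope *)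

Lemma p_map_R_weight1 (k : fieldType) (p : nat) (L : lmodType k)
    (br : L -> L -> L) (pm R : L -> L) (x : L) :
    lie_algebra br -> p_map p br pm ->
  p_map_R p 1 br pm R x = pm (x + R x) - pm (R x).
Proof.
move=> brL [_ _ pmD]; rewrite pmD /p_map_R expr1n scale1r.
rewrite -[RHS]addrA [X in _ = _ + X]addrC addrA addrK; congr (_ + _).
apply: eq_big_nat => r rp; rewrite jacobson_s_compositions //.
by rewrite expr1n mulr1.
Qed.

Lemma ad_txy_morph (k : fieldType) (L M : lmodType k) (brL : L -> L -> L)
    (brM : M -> M -> M) (f : L -> M) (x y : L) (v : nat -> L) :
    linear f -> (forall u v, f (brL u v) = brM (f u) (f v)) ->
  forall n i, f (iter n (ad_txy brL x y) v i) =
    iter n (ad_txy brM (f x) (f y)) (fun j => f (v j)) i.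
Proof.
move=> fL fbr; elim=> [//|n IH] i; rewrite !iterS {1 3}/ad_txy.
by rewrite (linearP_D fL) fbr IH; case: i => [|i];
  rewrite ?(linearP_0 fL) ?fbr ?IH.
Qed.

Lemma jacobson_s_morph (k : fieldType) p (L M : lmodType k)
    (brL : L -> L -> L) (brM : M -> M -> M) (f : L -> M) i x y :
    linear f -> (forall u v, f (brL u v) = brM (f u) (f v)) ->
  f (jacobson_s p brL i x y) = jacobson_s p brM i (f x) (f y).
Proof.
move=> fL fbr; rewrite /jacobson_s (linearP_Z fL) (ad_txy_morph _ _ _ fL fbr).
rewrite (_ : (fun j => f _) = fun j => if j == 0%N then f x else 0) //.
by apply/funext => j; case: ifP => // _; apply: linearP_0.
Qed.

Lemma iter_br_morph (L M : Type) (brL : L -> L -> L) (brM : M -> M -> M)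
    (f : L -> M) (x : L) :
    (forall v, f (brL x v) = brM (f x) (f v)) ->
  forall n v, f (iter n (brL x) v) = iter n (brM (f x)) (f v).
Proof. by move=> fbr; elim=> // n IH v; rewrite !iterS fbr IH. Qed.

Lemma p_map_iter (k : fieldType) p (L : lmodType k) (br : L -> L -> L)
    (pm : L -> L) x y n :
  p_map p br pm -> br (iter n pm x) y = iter (p ^ n) (br x) y.
Proof.
move=> [_ pmbr _]; elim: n y => [//|n IH] y.
rewrite iterS pmbr expnS iterM; congr (iter p _ y).
exact/funext.
Qed.

Lemma commutator_lie (k : fieldType) (A : algType k) :
  lie_algebra (@commutator k A).
Proof.
split=> [x|y|x|x y z]; rewrite /commutator ?subrr //.
- exact: comm_linearr.
- exact: comm_linearl.
rewrite !mulrBr !mulrBl !mulrA !opprB !addrA.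
by rewrite [LHS](ACl ((1*12)*(2*7)*(3*10)*(4*5)*(6*11)*(8*9))) /= !(subrr,
  addNr, addr0).
Qed.

(** * The restricted Rota-Baxter structure on the primitive elements *)

Section Envelope.
Variables (k : fieldType) (p : nat).
Hypothesis charkp : p \in [pchar k].
Variables (g : lmodType k) (br : g -> g -> g).
Hypothesis brL : lie_algebra br.
Notation U := (uea br).
Notation gen := (uea_gen br).
Notation comm := (@commutator k (uea br)).
Notation gpset := (gp_set p br).

Let p_pr : prime p := pcharf_prime charkp.

Lemma iter_comm_pX (x y : U) n : comm (x ^+ (p ^ n)) y = iter (p ^ n) (comm x)
  y.
Proof.
elim: n y => [|n IH] y; first by rewrite expr1.
rewrite expnSr exprM -(iter_comm_p charkp) mulnC iterM; congr (iter p _ y).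
exact/funext.
Qed.

Lemma gp_set_gen x : gpset (gen x).
Proof. by have := gp_set_genX p br x 0; rewrite expr1. Qed.

Let is_gen (u : U) := exists x, u = gen x.

Let is_gen_submodule : submodule is_gen.
Proof.
split; first by exists 0; rewrite (linearP_0 (@uea_gen_linear _ _ br)).
by move=> a _ _ [x ->] [y ->]; exists (a *: x + y); rewrite uea_gen_linear.
Qed.

Let is_gen_iter x n u : is_gen u -> is_gen (iter n (comm (gen x)) u).
Proof.
move=> [y ->]; exists (iter n (br x) y).
by rewrite (iter_br_morph (brM := comm)) // => v; rewrite uea_gen_br.
Qed.

Lemma comm_anti (u v : U) : comm u v = - comm v u.
Proof. by rewrite /commutator opprB. Qed.

(** [ad (x ^ (p ^ n))] is [(ad x) ^ (p ^ n)], which preserves [g]. For general [v], already the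
    first application [[x, v] = - [v, x]] lies in [g]. *)
Lemma gp_set_comm_gen u v : gpset u -> gpset v -> is_gen (comm u v).
Proof.
have comm_gen w y : gpset w -> is_gen (comm w (gen y)).
  move: w; apply: gp_set_ind => [|x n].
    exact/submodule_preim/is_gen_submodule/comm_linearl.
  by rewrite iter_comm_pX; apply: is_gen_iter; exists y.
move=> gu gv; move: u gu; apply: gp_set_ind => [|x n].
  exact/submodule_preim/is_gen_submodule/comm_linearl.
have pn_gt0 : (0 < p ^ n)%N by rewrite expn_gt0 prime_gt0.
rewrite iter_comm_pX -(prednK pn_gt0) iterSr; apply: is_gen_iter.
by rewrite comm_anti; apply: (submoduleN is_gen_submodule); apply: comm_gen.
Qed.

Lemma gp_set_comm u v : gpset u -> gpset v -> gpset (comm u v).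
Proof. by move=> gu gv; have [x ->] := gp_set_comm_gen gu gv;
  apply: gp_set_gen. Qed.

(** Since [p - 1 > 0], the outermost operation is a commutator of elements of [gp_set], hence lands
    in [g]. *)
Lemma gp_set_jacobson i u v :
  gpset u -> gpset v -> is_gen (jacobson_s p comm i u v).
Proof.
move=> gu gv; apply: (submoduleZ is_gen_submodule).
have p1_gt0 : (0 < p.-1)%N by rewrite -subn1 subn_gt0 prime_gt1.
have gp0 := submodule0 (gp_set_submodule p br).
set s := fun n => _.
have gpiter n j : gpset (iter n (ad_txy comm u v) s j).
  elim: n j => [|n IH] j; first by rewrite /s /=; case: ifP.
  rewrite iterS /ad_txy; apply: (submoduleD (gp_set_submodule p br)).
    by case: j => // j; apply: gp_set_comm.
  exact: gp_set_comm.
rewrite -(prednK p1_gt0) iterS /ad_txy; apply: (submoduleD is_gen_submodule).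
  case: i.-1 => [|j]; first exact: submodule0.
  exact: gp_set_comm_gen.
exact: gp_set_comm_gen.
Qed.

Variables (I : choiceType) (e : I -> g) (le : rel I).
Hypotheses (le_total : total_order le) (e_basis : is_basis e).

Lemma gp_set_basis_ind (S : U -> Prop) : submodule S ->
  (forall i n, S (gen (e i) ^+ (p ^ n))) -> forall u, gpset u -> S u.
Proof.
move=> subS Se u /(gp_set_primitives charkp).
exact: (primitives_basis charkp brL le_total e_basis).
Qed.

Lemma gp_set_eq_primitives : gpset = primitives br.
Proof.
apply/seteqP; split=> u; first exact: (gp_set_primitives charkp).
apply: (primitives_basis charkp brL le_total e_basis) => [|i n].
  exact: gp_set_submodule.
exact: gp_set_genX.
Qed.

Lemma gp_setX u : gpset u -> gpset (u ^+ p).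
Proof. by rewrite gp_set_eq_primitives; apply: primitivesX. Qed.

(** Prescribing [e i] at the one-letter word [i] gives a linear left inverse. *)
Lemma uea_gen_inj : injective gen.
Proof.
have [f [fL fE]] := pbw_extension brL le_total e_basis
  (fun w => if w is i :: _ then e i else 0).
have fgen x : f (gen x) = x.
  move: x; apply: (basis_ext e_basis (h := id)) => // [a x y|i].
    by rewrite uea_gen_linear fL.
  have <- : word br e [:: i] = gen (e i) by rewrite /word big_seq1.
  by rewrite fE.
by move=> x y /(congr1 f); rewrite !fgen.
Qed.

Variables (R : g -> g) (RU : U -> U).
Hypothesis RUP : rb_extension br R RU.

Let RU_linear : linear RU. Proof. by case: RUP. Qed.
Let RU_gen x : RU (gen x) = gen (R x). Proof. by case: RUP. Qed.
Let RU1 : RU 1 = 1. Proof. by case: RUP. Qed.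

(** The identity that defines the extension on [g], demanded of [u]; the aim is to propagate it to
    [gp_set]. *)
Let rb_factor (u : U) :=
  gpset (RU u) /\ forall v, RU u * RU v = RU (u * v + comm (RU u) v).

Let rb_factor_submodule : submodule rb_factor.
Proof.
split=> [|a u w [gu Ru] [gw Rw]].
  have RU0 := linearP_0 RU_linear.
  split=> [|v]; first by rewrite RU0; apply: submodule0 (gp_set_submodule p br).
  by rewrite RU0 /commutator !mul0r mulr0 subrr addr0 RU0.
split=> [|v]; first by rewrite RU_linear; apply: (gp_set_submodule p br).2.
rewrite RU_linear mul_linearl Ru Rw -RU_linear mul_linearl comm_linearl.
by rewrite scalerDr addrACA.
Qed.

Let rb_factor_gen x : rb_factor (gen x).
Proof.
split=> [|v]; first by rewrite RU_gen; apply: gp_set_gen.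
have [_ _ _ RUM] := RUP.
by rewrite (linearP_D RU_linear) RUM addrNK.
Qed.

(* Left multiplication by [u] plus [ad (RU u)] is the difference of the
   commuting operators [u + RU u] on the left and [RU u] on the right, so its
   [p]-th power is the difference of their [p]-th powers. *)
Let rb_pth_power u v : rb_factor u -> RU u ^+ p * RU v =
  RU ((u + RU u) ^+ p * v - v * RU u ^+ p).
Proof.
move=> [_ Ru]; have charU : p \in [pchar U] by rewrite pchar_lalg.
rewrite -(iter_ad_p charU); elim: (p) v => [|n IH] v; first by rewrite mul1r.
rewrite exprS -mulrA IH Ru iterS; congr RU.
by rewrite mulrDl /commutator addrA.
Qed.

(** The case [v = 1]. Through [p_map_R_weight1] this is the compatibility of [R] with the
    [p]-map. *)
Let rb_shift_power u : rb_factor u ->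
  RU ((u + RU u) ^+ p - RU u ^+ p) = RU u ^+ p.
Proof. by move=> /(rb_pth_power 1); rewrite RU1 !mulr1 mul1r. Qed.

(** The difference [(u + RU u) ^ p - (RU u) ^ p] inherits the identity from [rb_pth_power], and it
    differs from [u ^ p] by Jacobson terms, which lie in [g]. *)
Let rb_factorX u : gpset u -> rb_factor u -> rb_factor (u ^+ p).
Proof.
move=> gu uP; have [gRu _] := uP.
have zP : rb_factor ((u + RU u) ^+ p - RU u ^+ p).
  split=> [|v]; rewrite rb_shift_power //; first exact: gp_setX.
  rewrite rb_pth_power //; congr RU.
  by rewrite mulrBl /commutator addrA subrK.
have -> : u ^+ p = (u + RU u) ^+ p - RU u ^+ p -
    \sum_(1 <= i < p) jacobson_s p comm i u (RU u).
  by rewrite (jacobson_formula charkp) addrAC addrK addrK.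
apply: (submoduleB rb_factor_submodule) => //.
have [y ->] : is_gen (\sum_(1 <= i < p) jacobson_s p comm i u (RU u)).
  apply: (submodule_sum is_gen_submodule) => i _ _.
  exact: gp_set_jacobson.
exact: rb_factor_gen.
Qed.

Lemma gp_set_rb_factor u : gpset u -> rb_factor u.
Proof.
apply: gp_set_ind => // x n.
elim: n => [|n IH]; first by rewrite expr1.
rewrite expnSr exprM; apply: rb_factorX => //; exact: gp_set_genX.
Qed.

Notation gpT := (gp p br).

(** The default [0] outside [gp_set] is harmless: each operation defined with [inj] is shown to stay
    inside. *)
Let inj (u : U) : gpT := insubd (0 : gpT) u.

Let injK u : gpset u -> gp_val (inj u) = u.
Proof. by move=> gu; apply: insubdK; apply/asboolP. Qed.

Let gp_valP (u : gpT) : gpset (gp_val u).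
Proof. by apply/asboolP; apply: valP u. Qed.

Let gp_val_linear : linear (@gp_val k p g br).
Proof. by move=> a u v; rewrite -[gp_val _]/(val _) linearP. Qed.

Let gp_val_inj (u v : gpT) : gp_val u = gp_val v -> u = v.
Proof. exact: val_inj. Qed.

Definition gp_bracket (u v : gpT) : gpT := inj (comm (gp_val u) (gp_val v)).
Definition gp_power (u : gpT) : gpT := inj (gp_val u ^+ p).
Definition gp_rb (u : gpT) : gpT := inj (RU (gp_val u)).
Definition gp_gen (x : g) : gpT := inj (gen x).

Lemma gp_bracketE u v :
  gp_val (gp_bracket u v) = comm (gp_val u) (gp_val v).
Proof. by apply: injK; apply: gp_set_comm. Qed.

Lemma gp_powerE u : gp_val (gp_power u) = gp_val u ^+ p.
Proof. by apply: injK; apply: gp_setX. Qed.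

Lemma gp_rbE u : gp_val (gp_rb u) = RU (gp_val u).
Proof. by apply: injK; have [] := gp_set_rb_factor (gp_valP u). Qed.

Lemma gp_genE x : gp_val (gp_gen x) = gen x.
Proof. exact/injK/gp_set_gen. Qed.

Lemma gp_lie_algebra : lie_algebra gp_bracket.
Proof.
have [cl cr cx cJ] := commutator_lie U.
have vD := linearP_D gp_val_linear.
split=> [x a u v|y a u v|x|x y z]; apply: gp_val_inj.
- by rewrite !(gp_val_linear, gp_bracketE) cl.
- by rewrite !(gp_val_linear, gp_bracketE) cr.
- by rewrite gp_bracketE cx.
- by rewrite !(vD, gp_bracketE) cJ.
Qed.

Lemma gp_p_map : p_map p gp_bracket gp_power.
Proof.
have vD := linearP_D gp_val_linear.
split=> [a x|x y|x y]; apply: gp_val_inj.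
- by rewrite !(linearP_Z gp_val_linear, gp_powerE) exprZn.
- rewrite (iter_br_morph (f := @gp_val k p g br) (brM := comm)); last first.
    by move=> v; rewrite gp_bracketE.
  by rewrite gp_bracketE gp_powerE (iter_comm_p charkp).
- rewrite !vD !gp_powerE vD (jacobson_formula charkp); congr (_ + _).
  rewrite (linearP_sum gp_val_linear); apply: eq_bigr => i _.
  by rewrite (jacobson_s_morph _ _ _ _ gp_val_linear gp_bracketE).
Qed.

Lemma gp_restricted : restricted_rb_lie_algebra p 1 gp_bracket gp_power gp_rb.
Proof.
have vD := linearP_D gp_val_linear.
split; last 2 first.
- exact: gp_p_map.
- move=> u; rewrite (p_map_R_weight1 _ _ gp_lie_algebra gp_p_map).
  apply: gp_val_inj; rewrite gp_rbE (linearP_B gp_val_linear) !gp_powerE vD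
    !gp_rbE.
  by apply: rb_shift_power; apply: gp_set_rb_factor.
split; first exact: gp_lie_algebra.
split=> [a u v|u v]; apply: gp_val_inj.
  by rewrite gp_val_linear !gp_rbE gp_val_linear RU_linear.
rewrite scale1r !vD !(gp_bracketE, gp_rbE) -!(linearP_D RU_linear).
have [_ uP] := gp_set_rb_factor (gp_valP u).
have [_ vP] := gp_set_rb_factor (gp_valP v).
rewrite {1}/commutator uP vP -(linearP_B RU_linear); congr RU.
rewrite /commutator !opprD !opprK !addrA.
by rewrite [LHS](ACl (2*3*6*5*1*4)).
Qed.

Lemma gp_ind_power (S : gpT -> Prop) : submodule S ->
  (forall x, S (gp_gen x)) -> (forall u, S u -> S (gp_power u)) ->
  forall u, S u.
Proof.
move=> subS Sgen SX u.
(* The induction takes place in [U], where [S] becomes the existence of a lift in [S]; injectivity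
   of [gp_val] brings it back. *)
suff [w [/gp_val_inj-> //]] : exists w : gpT, gp_val w = gp_val u /\ S w.
move: (gp_val u) (gp_valP u) => {u}; apply: gp_set_ind => [|x n].
  split; first by exists 0; split;
    [exact: (linearP_0 gp_val_linear)|exact: submodule0].
  move=> a _ _ [u [<- Su]] [v [<- Sv]]; exists (a *: u + v).
  by split; [rewrite gp_val_linear | apply: subS.2].
elim: n => [|n [u [uE Su]]]; first by exists (gp_gen x); rewrite gp_genE expr1.
by exists (gp_power u); rewrite gp_powerE uE -exprM -expnSr; split=> //;
  apply: SX.
Qed.

Lemma gp_basis_ind (S : gpT -> Prop) : submodule S ->
  (forall u i n, gp_val u = gen (e i) ^+ (p ^ n) -> S u) -> forall u, S u.
Proof.
move=> subS Se u.
suff [w [/gp_val_inj-> //]] : exists w : gpT, gp_val w = gp_val u /\ S w.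
move: (gp_val u) (gp_valP u) => {u}; apply: gp_set_basis_ind => [|i n].
  split; first by exists 0; split;
    [exact: (linearP_0 gp_val_linear)|exact: submodule0].
  move=> a _ _ [u [<- Su]] [v [<- Sv]]; exists (a *: u + v).
  by split; [rewrite gp_val_linear | apply: subS.2].
have vE := injK (gp_set_genX p br (e i) n).
by exists (inj (gen (e i) ^+ (p ^ n))); split=> //; apply: Se vE.
Qed.

Lemma gp_envelope :
  rb_p_envelope p 1 br R gp_bracket gp_power gp_rb gp_gen.
Proof.
split.
- exact: gp_restricted.
- split=> [a x y|x y|x]; apply: gp_val_inj.
  + by rewrite gp_val_linear !gp_genE uea_gen_linear.
  + by rewrite gp_bracketE !gp_genE uea_gen_br.
  + by rewrite gp_rbE !gp_genE RU_gen.
- by move=> x y /(congr1 (@gp_val k p g br)); rewrite !gp_genE => /uea_gen_inj.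
- apply/seteqP; split=> // u _ S [[[S0 SP] _ _ SX] Sgen].
  by apply: (gp_ind_power (S := S)) => // x; apply: Sgen; exists x.
Qed.

(** * The universal property *)

Section Universal.
Variables (c : lmodType k) (brc : c -> c -> c) (pmc Rc : c -> c).
Hypothesis cP : restricted_rb_lie_algebra p 1 brc pmc Rc.
Variable f : g -> c.
Hypothesis fP : rb_hom br R brc Rc f.

Let brcL : lie_algebra brc. Proof. by case: cP => -[]. Qed.
Let pmcP : p_map p brc pmc. Proof. by case: cP. Qed.
Let RcL : linear Rc. Proof. by case: cP => -[_ []]. Qed.
Let fL : linear f. Proof. by case: fP. Qed.
Let fbr x y : f (br x y) = brc (f x) (f y). Proof. by case: fP. Qed.
Let fR x : f (R x) = Rc (f x). Proof. by case: fP. Qed.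

Lemma gp_hom_exists :
  exists h : gpT -> c,
    restricted_rb_hom gp_bracket gp_power gp_rb brc pmc Rc h /\ h \o gp_gen = f.
Proof.
(* Only the values at the words [e_i ^ (p ^ n)] matter, where [logn p] of the length recovers [n];
   the values at other words are arbitrary. *)
have [hU [hUL hUE]] := pbw_extension brL le_total e_basis
  (fun w => if w is i :: _ then iter (logn p (size w)) pmc (f (e i)) else 0).
have hUX i n : hU (gen (e i) ^+ (p ^ n)) = iter n pmc (f (e i)).
  have pn_gt0 : (0 < p ^ n)%N by rewrite expn_gt0 prime_gt0.
  rewrite -word_nseq hUE; last first.
    elim: (p ^ n)%N => // -[|m] //= ->; case: le_total => -[[rf _] _] _.
    by rewrite rf.
  by rewrite -(prednK pn_gt0) /= size_nseq (prednK pn_gt0) pfactorK.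
have hUgen x : hU (gen x) = f x.
  move: x; apply: (basis_ext e_basis) => // [a x y|i].
    by rewrite uea_gen_linear hUL.
  by have := hUX i 0; rewrite expr1.
have hU_comm_gen u y : gpset u -> hU (comm u (gen y)) = brc (hU u) (f y).
  move: u; apply: gp_set_basis_ind => [|i n].
    apply: submodule_eq => a v w; first by rewrite comm_linearl hUL.
    by rewrite hUL (lie_linearl brcL).
  rewrite iter_comm_pX -(iter_br_morph (f := gen) (brL := br)); last first.
    by move=> v; rewrite uea_gen_br.
  by rewrite hUgen hUX (p_map_iter _ _ _ pmcP) (iter_br_morph (brM := brc)).
have hU_comm u v : gpset u -> gpset v ->
    hU (comm u v) = brc (hU u) (hU v).
  move=> gu gv; move: u gu; apply: gp_set_basis_ind => [|i n].
    apply: submodule_eq => a w w'; first by rewrite comm_linearl hUL.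
    by rewrite hUL (lie_linearl brcL).
  rewrite iter_comm_pX hUX (p_map_iter _ _ _ pmcP).
  elim: (p ^ n)%N => // m IH; rewrite !iterS -IH.
  rewrite comm_anti (linearP_N hUL) hU_comm_gen -?(lie_anti brcL) //.
  by elim: m {IH} => // m IH; rewrite iterS; apply: gp_set_comm;
    [exact: gp_set_gen|].
pose h (u : gpT) := hU (gp_val u).
have hL : linear h by move=> a u v; rewrite /h gp_val_linear hUL.
have hbr u v : h (gp_bracket u v) = brc (h u) (h v).
  by rewrite /h gp_bracketE hU_comm.
have hgen x : h (gp_gen x) = f x by rewrite /h gp_genE hUgen.
have [pmZ _ pmD] := gp_p_map; have [pmcZ _ pmcD] := pmcP.
(* The elements where [h] respects the [p]-map form a submodule, since [h] preserves brackets and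
   hence the Jacobson terms; basis elements satisfy the equation by the choice of [hU]. *)
have hpm u : h (gp_power u) = pmc (h u).
  move: u; apply: gp_basis_ind => [|u i n uE].
    split=> [|a u v IHu IHv].
      have pm0 : gp_power 0 = 0.
        by have := pmZ 0 0; rewrite scale0r expr0n gtn_eqF ?prime_gt0 //
          scale0r.
      rewrite pm0 (linearP_0 hL); have := pmcZ 0 0.
      by rewrite scale0r expr0n gtn_eqF ?prime_gt0 // scale0r.
    rewrite hL pmD pmcD !(linearP_D hL) pmZ pmcZ (linearP_Z hL) IHu IHv.
    congr (_ + _); rewrite (linearP_sum hL); apply: eq_bigr => j _.
    by rewrite (jacobson_s_morph _ _ _ _ hL hbr) (linearP_Z hL).
  by rewrite /h gp_powerE uE -exprM -expnSr !hUX.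
have [_ _ gpR] := gp_restricted; have [_ _ cR] := cP.
have gpRL : linear gp_rb by have [[_ []]] := gp_restricted.
have hR u : h (gp_rb u) = Rc (h u).
  move: u; apply: gp_ind_power => [|x|u IH].
  - by apply: submodule_eq => a u v; rewrite ?gpRL !hL ?RcL.
  - have -> : gp_rb (gp_gen x) = gp_gen (R x).
      by apply: gp_val_inj; rewrite gp_rbE !gp_genE RU_gen.
    by rewrite !hgen.
  have := gpR u; have := cR (h u).
  rewrite (p_map_R_weight1 _ _ gp_lie_algebra gp_p_map).
  rewrite (p_map_R_weight1 _ _ brcL pmcP) => cRu gpRu.
  (* [u ^ p] is [(u + R u) ^ p - (R u) ^ p], whose image under [R] is [(R u) ^ p], minus the
     Jacobson terms, which form an element [y] of [g]. As [h] commutes with [R] at [u] and on [g],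
     and the same identity holds in [c], it does so at [u ^ p]. *)
  have [y yE] : exists y, gp_power (u + gp_rb u) - gp_power (gp_rb u) -
      gp_power u = gp_gen y.
    have [y yE] : is_gen (\sum_(1 <= i < p)
        jacobson_s p comm i (gp_val u) (gp_val (gp_rb u))).
      by apply: (submodule_sum is_gen_submodule) => i _ _;
        apply: gp_set_jacobson.
    exists y; apply: gp_val_inj.
    rewrite !(linearP_B gp_val_linear) !gp_powerE (linearP_D gp_val_linear)
      gp_genE.
    rewrite (jacobson_formula charkp) yE [LHS](ACl ((1*5)*(2*4)*3)) /=.
    by rewrite !subrr !add0r.
  have powE : gp_power u = gp_power (u + gp_rb u) - gp_power (gp_rb u) - gp_gen
    y.
    by rewrite -yE opprB addrC subrK.
  have RgenE : h (gp_rb (gp_gen y)) = Rc (h (gp_gen y)).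
    have -> : gp_rb (gp_gen y) = gp_gen (R y).
      by apply: gp_val_inj; rewrite gp_rbE !gp_genE RU_gen.
    by rewrite !hgen.
  rewrite {1}powE (linearP_B gpRL) gpRu (linearP_B hL) RgenE hpm IH -cRu.
  rewrite -(linearP_B RcL); congr Rc.
  by rewrite -yE !(linearP_B hL) !hpm (linearP_D hL) IH opprB addrC subrK.
exists h; split; first by split.
by apply/funext => x; rewrite /= hgen.
Qed.

Lemma gp_hom_unique (h h' : gpT -> c) :
  restricted_rb_hom gp_bracket gp_power gp_rb brc pmc Rc h ->
  restricted_rb_hom gp_bracket gp_power gp_rb brc pmc Rc h' ->
  h \o gp_gen = h' \o gp_gen -> h = h'.
Proof.
move=> [[hL _ _] hpm] [[h'L _ _] h'pm] hh'; apply/funext.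
apply: gp_ind_power => [|x|u IH]; first exact: submodule_eq.
  exact: (congr1 (fun F => F x) hh').
by rewrite hpm h'pm IH.
Qed.

End Universal.

Lemma gp_universal :
  universal_rb_p_envelope p 1 br R gp_bracket gp_power gp_rb gp_gen.
Proof.
split=> [|c brc pmc Rc cP f fP]; first exact: gp_envelope.
have [h [hP hf]] := gp_hom_exists cP fP; exists h; split=> // h' [h'P h'f].
by apply: gp_hom_unique hP h'P _; rewrite hf h'f.
Qed.

End Envelope.

Theorem theorem4p22 (k : closedFieldType) (p : nat) (charkp : p \in [pchar k])
    (g : lmodType k) (br : g -> g -> g) (R : g -> g)
    (gRB : rb_lie_algebra 1 br R) :
  gp_set p br = primitives br /\
  exists RU : uea br -> uea br,
    unique (rb_extension br R) RU /\
    exists (br' : gp p br -> gp p br -> gp p br) (pm' R' : gp p br -> gp p br)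
           (i : g -> gp p br),
      [/\ forall u v, gp_val (br' u v) = commutator (gp_val u) (gp_val v),
          forall u, gp_val (pm' u) = gp_val u ^+ p,
          forall u, gp_val (R' u) = RU (gp_val u),
          forall x, gp_val (i x) = uea_gen br x &
          universal_rb_p_envelope p 1 br R br' pm' R' i].
Proof.
have brL := gRB.1.
have [I [e [le [le_total e_basis]]]] := exists_ordered_basis g.
split; first exact: (gp_set_eq_primitives charkp brL le_total e_basis).
have [RU RUP] := rb_extension_exists gRB.
exists RU; split; first by split=> // RU'; apply: rb_extension_unique.
exists (@gp_bracket k p g br), (@gp_power k p g br), (gp_rb RU), (gp_gen p br).
split.
- exact: (gp_bracketE charkp).
- exact: (gp_powerE charkp brL le_total e_basis).
- exact: (gp_rbE charkp brL le_total e_basis RUP).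
- exact: gp_genE.
- exact: (gp_universal charkp brL le_total e_basis RUP).
Qed.
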